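(* Let $A$ be an associative algebra over a field $\Bbbk$, let $X$ be a well-ordered linear basis of $A$, and let $U$ be the set of all nonempty non-associative words in $X$. A linear basis of the universal enveloping pre-associative algebra $U_*(A)$ consists of (the images of) all elements $u_1*u_2*\dots*u_n$, $n\ge 1$, $u_i\in U$, such that $|u_2|,\dots,|u_n|>1$ and none of the $u_i$ contains a subword of the form $w(xv)$ with $w,v\in U$, $x\in X$. In particular, the triple $(\mathrm{preAs},\mathrm{As},( * ))$ has the PBW-property: for every associative algebra $A$, $\mathrm{gr}\,U_*(A)\simeq U_*(A^{(0)})$ as pre-associative algebras.
   Context: A pre-associative (dendriform) algebra is a $\Bbbk$-linear space with two bilinear operations $\succ,\prec$ satisfying $x\succ(y\succ z)=(x\succ y)\succ z+(x\prec y)\succ z$, $x\succ(y\prec z)=(x\succ y)\prec z$, $x\prec(y\succ z)+x\prec(y\prec z)=(x\prec y)\prec z$. Put $x*y=x\succ y+x\prec y$ and $xy=x\succ y$; non-associative words are taken with respect to the product $xy$, and $|u|$ denotes the length of a word $u$. Every pre-associative algebra $P$ is an associative algebra $P^{(+)}$ under $*$. For an associative algebra $A$ with product $\cdot$, the universal enveloping pre-associative algebra $U_*(A)$ is a pre-associative algebra with a homomorphism $\iota: A\to U_*(A)^{(+)}$ such that $U_*(A)$ is generated by $\iota(A)$ and every homomorphism of associative algebras $A\to P^{(+)}$, $P$ pre-associative, extends to a homomorphism $U_*(A)\to P$ of pre-associative algebras. Explicitly, if $X$ is a linear basis of $A$, then $U_*(A)$ is the quotient of the free pre-associative algebra $\mathrm{preAs}\langle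 X\rangle$ by the ideal generated by all $x*y-x\cdot y$, $x,y\in X$ (where $x\cdot y$ is the corresponding linear combination of elements of $X$). $A^{(0)}$ is the associative algebra on the same linear space as $A$ with zero multiplication. $\mathrm{gr}\,U_*(A)$ is the associated graded pre-associative algebra of the natural ascending filtration of $U_*(A)$, whose $n$-th term is the span of all products (with operations $\succ,\prec$, any bracketing) of at most $n$ elements of $\iota(A)$. *)

(* Defs.v *)
From HB Require Import structures.
From mathcomp Require Import all_boot all_algebra.
From mathcomp Require Import generic_quotient ring_quotient.
From mathcomp Require Import boolp functions wochoice.

Set Implicit Arguments.
Unset Strict Implicit.
Unset Printing Implicit Defensive.

Import GRing.Theory.
Local Open Scope ring_scope.
Local Open Scope quotient_scope.

Reserved Notation "x ⋅ y" (at level 40, left associativity).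
Reserved Notation "x ≻ y" (at level 40, no associativity).
Reserved Notation "x ≺ y" (at level 40, no associativity).
Reserved Notation "x ∗ y" (at level 40, left associativity).

(* Algebras are not assumed to have a unit: every pre-associative algebra must
   give an associative algebra P^(+), and every associative algebra A a zero
   multiplication algebra A^(0), and these have no unit in general. This rules
   out the structure algType of MathComp. *)
HB.mixin Record Lmodule_isAssoc (k : fieldType) A of GRing.Lmodule k A := {
  amul : A -> A -> A;
  amulPl : forall (a : k) (x y z : A),
    amul (a *: x + y) z = a *: amul x z + amul y z;
  amulPr : forall (a : k) (x y z : A),
    amul z (a *: x + y) = a *: amul z x + amul z y;
  amulA : forall x y z : A, amul x (amul y z) = amul (amul x y) z }.

#[short(type="assocType")]
HB.structure Definition Assoc (k : fieldType) :=
  {A of Lmodule_isAssoc k A & GRing.Lmodule k A}.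

Notation "x ⋅ y" := (amul x y) : ring_scope.

HB.mixin Record Lmodule_isPreAs (k : fieldType) P of GRing.Lmodule k P := {
  presucc : P -> P -> P;
  preprec : P -> P -> P;
  presuccPl : forall (a : k) (x y z : P),
    presucc (a *: x + y) z = a *: presucc x z + presucc y z;
  presuccPr : forall (a : k) (x y z : P),
    presucc z (a *: x + y) = a *: presucc z x + presucc z y;
  preprecPl : forall (a : k) (x y z : P),
    preprec (a *: x + y) z = a *: preprec x z + preprec y z;
  preprecPr : forall (a : k) (x y z : P),
    preprec z (a *: x + y) = a *: preprec z x + preprec z y;
  presucc_succ : forall x y z : P,
    presucc x (presucc y z)
      = presucc (presucc x y) z + presucc (preprec x y) z;
  presucc_prec : forall x y z : P,
    presucc x (preprec y z) = preprec (presucc x y) z;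
  preprec_prec : forall x y z : P,
    preprec x (presucc y z) + preprec x (preprec y z)
      = preprec (preprec x y) z }.

#[short(type="preAsType")]
HB.structure Definition PreAs (k : fieldType) :=
  {P of Lmodule_isPreAs k P & GRing.Lmodule k P}.

Notation "x ≻ y" := (presucc x y) : ring_scope.
Notation "x ≺ y" := (preprec x y) : ring_scope.

Definition prestar (k : fieldType) (P : preAsType k) (x y : P) : P :=
  x ≻ y + x ≺ y.
Notation "x ∗ y" := (prestar x y) : ring_scope.

Section BilinearFacts.
Variables (k : fieldType) (U V W : lmodType k) (f : U -> V -> W).
Hypothesis fl : forall (a : k) x y z, f (a *: x + y) z = a *: f x z + f y z.
Hypothesis fr : forall (a : k) x y z, f z (a *: x + y) = a *: f z x + f z y.

Lemma bil0l z : f 0 z = 0.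
Proof. by have := fl (-1) 0 0 z; rewrite scaler0 addr0 scaleN1r addNr. Qed.
Lemma bil0r z : f z 0 = 0.
Proof. by have := fr (-1) 0 0 z; rewrite scaler0 addr0 scaleN1r addNr. Qed.
Lemma bilDl x y z : f (x + y) z = f x z + f y z.
Proof. by have := fl 1 x y z; rewrite !scale1r. Qed.
Lemma bilDr x y z : f z (x + y) = f z x + f z y.
Proof. by have := fr 1 x y z; rewrite !scale1r. Qed.
Lemma bilBl x y z : f (x - y) z = f x z - f y z.
Proof. by rewrite addrC -scaleN1r fl scaleN1r addrC. Qed.
Lemma bilBr x y z : f z (x - y) = f z x - f z y.
Proof. by rewrite addrC -scaleN1r fr scaleN1r addrC. Qed.
Lemma bil_suml I (r : seq I) (Q : pred I) (F : I -> U) z :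
  f (\sum_(i <- r | Q i) F i) z = \sum_(i <- r | Q i) f (F i) z.
Proof.
by apply: (big_morph (fun x => f x z)) => [x y|]; rewrite ?bilDl ?bil0l.
Qed.
Lemma bil_sumr I (r : seq I) (Q : pred I) (F : I -> V) z :
  f z (\sum_(i <- r | Q i) F i) = \sum_(i <- r | Q i) f z (F i).
Proof.
by apply: (big_morph (f z)) => [x y|]; rewrite ?bilDr ?bil0r.
Qed.
End BilinearFacts.

(* P^(+): the space of P with the product ∗. *)
Definition plus_alg (k : fieldType) (P : preAsType k) : Type := P.

Section PlusAlg.
Variables (k : fieldType) (P : preAsType k).
HB.instance Definition _ := GRing.Lmodule.copy (plus_alg P) P.

Lemma prestarPl (a : k) (x y z : P) :
  (a *: x + y) ∗ z = a *: (x ∗ z) + y ∗ z.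
Proof. by rewrite /prestar presuccPl preprecPl scalerDr addrACA. Qed.
Lemma prestarPr (a : k) (x y z : P) :
  z ∗ (a *: x + y) = a *: (z ∗ x) + z ∗ y.
Proof. by rewrite /prestar presuccPr preprecPr scalerDr addrACA. Qed.
Lemma prestarA (x y z : P) : x ∗ (y ∗ z) = x ∗ y ∗ z.
Proof.
rewrite /prestar.
rewrite !(bilDl (@presuccPl _ P)) !(bilDl (@preprecPl _ P)).
rewrite !(bilDr (@presuccPr _ P)) !(bilDr (@preprecPr _ P)).
by rewrite presucc_succ presucc_prec -preprec_prec !addrA.
Qed.

HB.instance Definition _ := @Lmodule_isAssoc.Build k (plus_alg P)
  (@prestar k P) prestarPl prestarPr prestarA.
End PlusAlg.

(* A^(0): the space of A with zero product. *)
Definition zero_alg (k : fieldType) (A : assocType k) : Type := A.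

Section ZeroAlg.
Variables (k : fieldType) (A : assocType k).
HB.instance Definition _ := GRing.Lmodule.copy (zero_alg A) A.

Definition zero_mul (x y : zero_alg A) : zero_alg A := 0.
Fact zero_mulPl (a : k) x y z :
  zero_mul (a *: x + y) z = a *: zero_mul x z + zero_mul y z.
Proof. by rewrite /zero_mul scaler0 addr0. Qed.
Fact zero_mulPr (a : k) x y z :
  zero_mul z (a *: x + y) = a *: zero_mul z x + zero_mul z y.
Proof. by rewrite /zero_mul scaler0 addr0. Qed.
Fact zero_mulA x y z : zero_mul x (zero_mul y z) = zero_mul (zero_mul x y) z.
Proof. by []. Qed.

HB.instance Definition _ := @Lmodule_isAssoc.Build k (zero_alg A)
  zero_mul zero_mulPl zero_mulPr zero_mulA.
End ZeroAlg.

Definition assoc_hom (k : fieldType) (A B : assocType k) (f : A -> B) : Prop :=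
  linear f /\ forall x y, f (x ⋅ y) = f x ⋅ f y.

Definition pre_hom (k : fieldType) (P Q : preAsType k) (f : P -> Q) : Prop :=
  [/\ linear f, forall x y, f (x ≻ y) = f x ≻ f y
    & forall x y, f (x ≺ y) = f x ≺ f y].

Definition pre_iso (k : fieldType) (P Q : preAsType k) : Prop :=
  exists2 f : P -> Q, pre_hom f & bijective f.

Definition pre_subalg (k : fieldType) (P : preAsType k) (S : P -> Prop) :
    Prop :=
  [/\ S 0, forall (a : k) x y, S x -> S y -> S (a *: x + y),
      forall x y, S x -> S y -> S (x ≻ y)
    & forall x y, S x -> S y -> S (x ≺ y)].

Definition pre_generated (k : fieldType) (P : preAsType k) (T : Type)
    (g : T -> P) : Prop :=
  forall S : P -> Prop, pre_subalg S -> (forall t, S (g t)) -> forall x, S x.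

Definition universal_envelope (k : fieldType) (A : assocType k)
    (U : preAsType k) (iota : A -> U) : Prop :=
  [/\ assoc_hom (iota : A -> plus_alg U),
      pre_generated iota
    & forall (P : preAsType k) (f : A -> plus_alg P), assoc_hom f ->
        exists2 g : U -> P, pre_hom g & forall a, g (iota a) = f a].

(* A basis as a family: in the first clause the indices t are pairwise distinct,
   so that the family b is in particular injective. *)
Definition lin_basis (k : fieldType) (V : lmodType k) (I : Type) (b : I -> V) :
    Prop :=
  (forall n (t : 'I_n -> I) (c : 'I_n -> k), injective t ->
     \sum_(i < n) c i *: b (t i) = 0 -> forall i, c i = 0)
  /\ (forall v, exists n (t : 'I_n -> I) (c : 'I_n -> k),
        v = \sum_(i < n) c i *: b (t i)).

Inductive word (X : Type) : Type :=
| Letter of X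
| Mul of word X & word X.

Fixpoint wlen X (u : word X) : nat :=
  if u is Mul u1 u2 then (wlen u1 + wlen u2)%N else 1%N.

Fixpoint subwords X (u : word X) : seq (word X) :=
  u :: (if u is Mul u1 u2 then subwords u1 ++ subwords u2 else [::]).

(* u = w(xv) for some words w, v and some letter x *)
Definition forbidden X (u : word X) : bool :=
  if u is Mul _ (Mul (Letter _) _) then true else false.

Definition reduced X (u : word X) : bool := ~~ has (@forbidden X) (subwords u).

(* The formal product u_1 * u_2 * ... * u_n, with u_1 = nf_head and
   [:: u_2; ...; u_n] = nf_tail. *)
Record normal_form (X : Type) := NormalForm {
  nf_head : word X;
  nf_tail : seq (word X);
  _ : [&& reduced nf_head, all (@reduced X) nf_tail
        & all (fun u => 1 < wlen u)%N nf_tail] }.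

Fixpoint word_val (k : fieldType) (P : preAsType k) X (x : X -> P)
    (u : word X) : P :=
  match u with
  | Letter i => x i
  | Mul u1 u2 => word_val x u1 ≻ word_val x u2
  end.

Definition nf_val (k : fieldType) (P : preAsType k) X (x : X -> P)
    (w : normal_form X) : P :=
  foldl (@prestar k P) (word_val x (nf_head w))
    [seq word_val x u | u <- nf_tail w].

Record filtration (k : fieldType) (P : preAsType k) := Filtration {
  fil :> nat -> P -> Prop;
  fil0 : forall n, fil n 0;
  filP : forall n (a : k) x y, fil n x -> fil n y -> fil n (a *: x + y);
  fil_mono : forall m n x, (m <= n)%N -> fil m x -> fil n x;
  fil_succ : forall m n x y, fil m x -> fil n y -> fil (m + n) (x ≻ y);
  fil_prec : forall m n x y, fil m x -> fil n y -> fil (m + n) (x ≺ y) }.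

Section NaturalFiltration.
Variables (k : fieldType) (P : preAsType k) (T : Type) (g : T -> P).

Inductive product_of : nat -> P -> Prop :=
| product_gen t : product_of 1 (g t)
| product_succ m n x y :
    product_of m x -> product_of n y -> product_of (m + n) (x ≻ y)
| product_prec m n x y :
    product_of m x -> product_of n y -> product_of (m + n) (x ≺ y).

Inductive span (S : P -> Prop) : P -> Prop :=
| span0 : span S 0
| spanP (a : k) x y : S x -> span S y -> span S (a *: x + y).

Definition natural_fil (n : nat) : P -> Prop :=
  span (fun x => exists2 m, (m <= n)%N & product_of m x).

Lemma span_lin (S : P -> Prop) (a : k) x y :
  span S x -> span S y -> span S (a *: x + y).
Proof.
move=> + Sy; elim=> [|b u v Su _ IH]; first by rewrite scaler0 add0r.
by rewrite scalerDr scalerA -addrA; apply: spanP.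
Qed.

Lemma span_sub (S S' : P -> Prop) x :
  (forall y, S y -> S' y) -> span S x -> span S' x.
Proof. by move=> SS'; elim=> *; [apply: span0|apply: spanP => //; apply: SS']. Qed.

Lemma span_bil (f : P -> P -> P) (S1 S2 S : P -> Prop) x y :
  (forall (a : k) x y z, f (a *: x + y) z = a *: f x z + f y z) ->
  (forall (a : k) x y z, f z (a *: x + y) = a *: f z x + f z y) ->
  (forall x y, S1 x -> S2 y -> S (f x y)) ->
  span S1 x -> span S2 y -> span S (f x y).
Proof.
move=> fl fr fS S1x S2y; elim: S1x => [|a u v S1u _ IH].
  by rewrite (bil0l fl); apply: span0.
rewrite fl; apply: span_lin => //.
elim: S2y => [|b s t S2s _ IHs]; first by rewrite (bil0r fr); apply: span0.
by rewrite fr; apply: spanP => //; apply: fS.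
Qed.

Fact natural_fil0 n : natural_fil n 0. Proof. exact: span0. Qed.
Fact natural_filP n (a : k) x y :
  natural_fil n x -> natural_fil n y -> natural_fil n (a *: x + y).
Proof. exact: span_lin. Qed.
Fact natural_fil_mono m n x : (m <= n)%N -> natural_fil m x -> natural_fil n x.
Proof.
by move=> mn; apply: span_sub => y [p pm ?]; exists p => //; apply: leq_trans mn.
Qed.
Fact natural_fil_succ m n x y :
  natural_fil m x -> natural_fil n y -> natural_fil (m + n) (x ≻ y).
Proof.
apply: span_bil; [exact: presuccPl|exact: presuccPr|].
move=> u v [p pm up] [q qn vq].
by exists (p + q)%N; [exact: leq_add|exact: product_succ].
Qed.
Fact natural_fil_prec m n x y :
  natural_fil m x -> natural_fil n y -> natural_fil (m + n) (x ≺ y).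
Proof.
apply: span_bil; [exact: preprecPl|exact: preprecPr|].
move=> u v [p pm up] [q qn vq].
by exists (p + q)%N; [exact: leq_add|exact: product_prec].
Qed.

Definition natural_filtration : filtration P :=
  Filtration natural_fil0 natural_filP natural_fil_mono
    natural_fil_succ natural_fil_prec.
End NaturalFiltration.

(* gr P, the direct sum of the quotients F_n / F_(n-1) for n >= 0 (F_(-1) = 0),
   is realized as the quotient of the direct sum of the F_n by the direct sum
   of the F_(n-1). Elements of the former are sequences f with finite support
   such that f n is in F_n; the n-th summand times the p-th one goes to the
   (n + p)-th one, so the products are convolutions. *)
Section AssociatedGraded.
Variables (k : fieldType) (P : preAsType k) (F : filtration P).

Definition fil_below (n : nat) (x : P) : Prop :=
  if n is m.+1 then F m x else x = 0.

Lemma fil_below0 n : fil_below n 0.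
Proof. by case: n => //= n; apply: fil0. Qed.
Lemma fil_belowP n (a : k) x y :
  fil_below n x -> fil_below n y -> fil_below n (a *: x + y).
Proof. by case: n => [/= -> ->|n]; [rewrite scaler0 addr0|apply: filP]. Qed.

Definition finsupp_in (B : nat -> P -> Prop) : {pred nat -> P} :=
  fun f => `[< (forall n, B n (f n))
               /\ exists N, forall n, (N <= n)%N -> f n = 0 >].

Lemma finsupp_in_closed (B : nat -> P -> Prop) :
  (forall n, B n 0) ->
  (forall n (a : k) x y, B n x -> B n y -> B n (a *: x + y)) ->
  submod_closed (finsupp_in B).
Proof.
move=> B0 BP; split; first by apply/asboolP; split=> //; exists 0%N.
move=> a f g /asboolP[Bf [M fM]] /asboolP[Bg [N gN]]; apply/asboolP; split.
  by move=> n; apply: BP.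
exists (maxn M N) => n; rewrite geq_max => /andP[Mn Nn].
by rewrite -[LHS]/(a *: f n + g n) fM // gN // scaler0 addr0.
Qed.

Definition rees_pred : {pred nat -> P} := finsupp_in F.
Fact rees_pred_closed : submod_closed rees_pred.
Proof. by apply: finsupp_in_closed; [apply: fil0|apply: filP]. Qed.
HB.instance Definition _ :=
  GRing.isSubmodClosed.Build k (nat -> P) rees_pred rees_pred_closed.

Record rees := Rees { rees_fun :> nat -> P; _ : rees_fun \in rees_pred }.
HB.instance Definition _ := [isSub for rees_fun].
HB.instance Definition _ := [Choice of rees by <:].
HB.instance Definition _ := [SubChoice_isSubLmodule of rees by <:].

Lemma reesP (f : rees) :
  (forall n, F n (f n)) /\ exists N, forall n, (N <= n)%N -> f n = 0.
Proof. by case: f => f /= /asboolP. Qed.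

Definition rees_low : {pred rees} :=
  fun f => (f : nat -> P) \in finsupp_in fil_below.
Fact rees_low_closed : submod_closed rees_low.
Proof.
have [h0 hP] := finsupp_in_closed fil_below0 fil_belowP.
by split=> [|a f g ? ?]; [apply: h0|apply: hP].
Qed.
HB.instance Definition _ :=
  GRing.isSubmodClosed.Build k rees rees_low rees_low_closed.

Section Convolution.
Variable f : P -> P -> P.
Hypothesis fl : forall (a : k) x y z, f (a *: x + y) z = a *: f x z + f y z.
Hypothesis fr : forall (a : k) x y z, f z (a *: x + y) = a *: f z x + f z y.
Hypothesis fF : forall m n x y, F m x -> F n y -> F (m + n) (f x y).

Definition conv_fun (u v : nat -> P) (n : nat) : P :=
  \sum_(i < n.+1) f (u i) (v (n - i)%N).

Lemma finsupp_conv (B1 B2 B : nat -> P -> Prop) u v :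
  (forall n, B n 0) ->
  (forall n (a : k) x y, B n x -> B n y -> B n (a *: x + y)) ->
  (forall m n x y, B1 m x -> B2 n y -> B (m + n)%N (f x y)) ->
  u \in finsupp_in B1 -> v \in finsupp_in B2 ->
  conv_fun u v \in finsupp_in B.
Proof.
move=> B0 BP Bf /asboolP[Bu [M uM]] /asboolP[Bv [N vN]]; apply/asboolP; split.
  move=> n; apply: (big_ind (B n)) => // [x y Bx By|i _].
    by rewrite -[x]scale1r; apply: BP.
  by rewrite -[n in B n](subnKC (ltnSE (ltn_ord i))); apply: Bf.
exists (M + N)%N => n MNn; rewrite /conv_fun big1 // => i _.
case: (leqP M i) => [Mi|iM]; first by rewrite uM // (bil0l fl).
rewrite vN ?(bil0r fr) // leq_subRL; last exact: ltnSE (ltn_ord i).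
by apply: leq_trans MNn; rewrite leq_add2r ltnW.
Qed.

Fact conv_subproof (u v : rees) : conv_fun u v \in rees_pred.
Proof.
by apply: (@finsupp_conv F F); [apply: fil0|apply: filP|apply: fF|apply: valP..].
Qed.
Definition conv (u v : rees) : rees := Rees (conv_subproof u v).

Lemma conv_linl (a : k) u v w :
  conv (a *: u + v) w = a *: conv u w + conv v w.
Proof.
apply: val_inj; apply/funext => n.
rewrite -[RHS]/(a *: conv_fun u w n + conv_fun v w n) scaler_sumr -big_split /=.
by apply: eq_bigr => i _; rewrite -fl.
Qed.
Lemma conv_linr (a : k) u v w :
  conv w (a *: u + v) = a *: conv w u + conv w v.
Proof.
apply: val_inj; apply/funext => n.
rewrite -[RHS]/(a *: conv_fun w u n + conv_fun w v n) scaler_sumr -big_split /=.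
by apply: eq_bigr => i _; rewrite -fr.
Qed.

Lemma conv_lowl u v : u \in rees_low -> conv u v \in rees_low.
Proof.
move=> ul; apply: (@finsupp_conv fil_below F) => //; last exact: valP.
- exact: fil_below0.
- exact: fil_belowP.
move=> [|m] n x y /=; first by move=> -> _; rewrite (bil0l fl); apply: fil_below0.
exact: fF.
Qed.
Lemma conv_lowr u v : v \in rees_low -> conv u v \in rees_low.
Proof.
move=> vl; apply: (@finsupp_conv F fil_below) => //; last exact: valP.
- exact: fil_below0.
- exact: fil_belowP.
move=> m [|n] x y /= Fx; first by move=> ->; rewrite (bil0r fr); apply: fil_below0.
by rewrite addnS; apply: fF.
Qed.
End Convolution.

Lemma conv3 (T : P -> P -> P -> P) (u v w : nat -> P) n :
  \sum_(i < n.+1) \sum_(j < (n - i).+1) T (u i) (v j) (w (n - i - j)%N)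
  = \sum_(i < n.+1) \sum_(j < i.+1) T (u j) (v (i - j)%N) (w (n - i)%N).
Proof.
pose G i j := T (u j) (v (i - j)%N) (w (n - i)%N).
transitivity (\sum_(0 <= i < n.+1) \sum_(0 <= j < n.+1 | (j <= i)%N) G i j).
  rewrite (exchange_big_dep_nat xpredT) //= big_mkord.
  apply: eq_bigr => i _; have iN : (i <= n)%N := ltnSE (ltn_ord i).
  transitivity (\sum_(i <= l < n.+1) G l i).
    rewrite -[X in \sum_(X <= _ < _) _]add0n big_addn subSn // big_mkord.
    by apply: eq_bigr => j _; rewrite /G addnK addnC subnDA.
  by rewrite (big_nat_widenl i 0).
rewrite big_mkord; apply: eq_bigr => i _.
rewrite -[RHS](big_mkord xpredT (G i)) (big_nat_widen 0 i.+1 n.+1) //.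
Qed.

Definition gr : Type := Quotient.quot rees_low.
HB.instance Definition _ := GRing.Zmodule.on gr.

Definition gr_pi : rees -> gr := \pi_(Quotient.quot rees_low).

Lemma gr_piP u v : gr_pi u = gr_pi v <-> u - v \in rees_low.
Proof. by rewrite Quotient.idealrBE; split=> [/eqP//|/eqP]. Qed.
Lemma gr_piD u v : gr_pi (u + v) = gr_pi u + gr_pi v.
Proof. exact: pi_addr. Qed.
Lemma gr_pi_surj (x : gr) : {u | gr_pi u = x}.
Proof. by exists (repr (x : Quotient.quot rees_low)); rewrite /gr_pi reprK. Qed.

Definition gr_repr (x : gr) : rees := sval (gr_pi_surj x).
Lemma gr_reprK : cancel gr_repr gr_pi.
Proof. by move=> x; rewrite /gr_repr; case: (gr_pi_surj x). Qed.
Lemma gr_repr_low u : gr_repr (gr_pi u) - u \in rees_low.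
Proof. by apply/gr_piP; rewrite gr_reprK. Qed.

Definition gr_scale (a : k) (x : gr) : gr := gr_pi (a *: gr_repr x).
Lemma gr_pi_scale a u : gr_scale a (gr_pi u) = gr_pi (a *: u).
Proof. by apply/gr_piP; rewrite -scalerBr rpredZ ?gr_repr_low. Qed.

Fact gr_scaleA a b x : gr_scale a (gr_scale b x) = gr_scale (a * b) x.
Proof. by rewrite -[x]gr_reprK !gr_pi_scale scalerA. Qed.
Fact gr_scale1 : left_id 1 gr_scale.
Proof. by move=> x; rewrite -[x]gr_reprK !gr_pi_scale scale1r. Qed.
Fact gr_scaleDr : right_distributive gr_scale +%R.
Proof.
move=> a x y; rewrite -[x]gr_reprK -[y]gr_reprK.
by rewrite -gr_piD !gr_pi_scale scalerDr gr_piD.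
Qed.
Fact gr_scaleDl x : {morph gr_scale^~ x : a b / a + b}.
Proof.
by move=> a b; rewrite -[x]gr_reprK !gr_pi_scale scalerDl gr_piD.
Qed.
HB.instance Definition _ := GRing.Zmodule_isLmodule.Build k gr
  gr_scaleA gr_scale1 gr_scaleDr gr_scaleDl.

Lemma gr_piZ a u : gr_pi (a *: u) = a *: gr_pi u.
Proof. exact: esym (gr_pi_scale a u). Qed.

Definition rees_succ :=
  conv (@presuccPl k P) (@presuccPr k P) (@fil_succ k P F).
Definition rees_prec :=
  conv (@preprecPl k P) (@preprecPr k P) (@fil_prec k P F).

Definition gr_succ (x y : gr) : gr := gr_pi (rees_succ (gr_repr x) (gr_repr y)).
Definition gr_prec (x y : gr) : gr := gr_pi (rees_prec (gr_repr x) (gr_repr y)).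

Lemma gr_pi_bil (f : rees -> rees -> rees)
    (fl : forall (a : k) x y z, f (a *: x + y) z = a *: f x z + f y z)
    (fr : forall (a : k) x y z, f z (a *: x + y) = a *: f z x + f z y)
    (lowl : forall u v, u \in rees_low -> f u v \in rees_low)
    (lowr : forall u v, v \in rees_low -> f u v \in rees_low) u v :
  gr_pi (f (gr_repr (gr_pi u)) (gr_repr (gr_pi v))) = gr_pi (f u v).
Proof.
apply/gr_piP; set u' := gr_repr _; set v' := gr_repr _.
have -> : f u' v' - f u v = f (u' - u) v' + f u (v' - v).
  by rewrite (bilBl fl) (bilBr fr) addrA subrK.
by apply: rpredD; [apply: lowl|apply: lowr]; apply: gr_repr_low.
Qed.

Lemma gr_pi_succ u v : gr_succ (gr_pi u) (gr_pi v) = gr_pi (rees_succ u v).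
Proof.
by apply: gr_pi_bil => *; [exact: conv_linl|exact: conv_linr|exact: conv_lowl|exact: conv_lowr].
Qed.
Lemma gr_pi_prec u v : gr_prec (gr_pi u) (gr_pi v) = gr_pi (rees_prec u v).
Proof.
by apply: gr_pi_bil => *; [exact: conv_linl|exact: conv_linr|exact: conv_lowl|exact: conv_lowr].
Qed.

Fact gr_succPl (a : k) (x y z : gr) :
  gr_succ (a *: x + y) z = a *: gr_succ x z + gr_succ y z.
Proof.
rewrite -[x]gr_reprK -[y]gr_reprK -[z]gr_reprK.
by rewrite -gr_piZ -gr_piD !gr_pi_succ -gr_piZ -gr_piD /rees_succ conv_linl.
Qed.
Fact gr_succPr (a : k) (x y z : gr) :
  gr_succ z (a *: x + y) = a *: gr_succ z x + gr_succ z y.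
Proof.
rewrite -[x]gr_reprK -[y]gr_reprK -[z]gr_reprK.
by rewrite -gr_piZ -gr_piD !gr_pi_succ -gr_piZ -gr_piD /rees_succ conv_linr.
Qed.
Fact gr_precPl (a : k) (x y z : gr) :
  gr_prec (a *: x + y) z = a *: gr_prec x z + gr_prec y z.
Proof.
rewrite -[x]gr_reprK -[y]gr_reprK -[z]gr_reprK.
by rewrite -gr_piZ -gr_piD !gr_pi_prec -gr_piZ -gr_piD /rees_prec conv_linl.
Qed.
Fact gr_precPr (a : k) (x y z : gr) :
  gr_prec z (a *: x + y) = a *: gr_prec z x + gr_prec z y.
Proof.
rewrite -[x]gr_reprK -[y]gr_reprK -[z]gr_reprK.
by rewrite -gr_piZ -gr_piD !gr_pi_prec -gr_piZ -gr_piD /rees_prec conv_linr.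
Qed.

Lemma conv_funAr (f1 f2 : P -> P -> P) (u v w : nat -> P) n
    (f1r : forall (a : k) x y z, f1 z (a *: x + y) = a *: f1 z x + f1 z y) :
  conv_fun f1 u (conv_fun f2 v w) n
  = \sum_(i < n.+1) \sum_(j < i.+1) f1 (u j) (f2 (v (i - j)%N) (w (n - i)%N)).
Proof.
rewrite -(conv3 (fun x y z => f1 x (f2 y z))); apply: eq_bigr => i _.
by rewrite (bil_sumr f1r).
Qed.
Lemma conv_funAl (f1 f2 : P -> P -> P) (u v w : nat -> P) n
    (f1l : forall (a : k) x y z, f1 (a *: x + y) z = a *: f1 x z + f1 y z) :
  conv_fun f1 (conv_fun f2 u v) w n
  = \sum_(i < n.+1) \sum_(j < i.+1) f1 (f2 (u j) (v (i - j)%N)) (w (n - i)%N).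
Proof. by apply: eq_bigr => i _; rewrite (bil_suml f1l). Qed.

Fact gr_succ_succ (x y z : gr) :
  gr_succ x (gr_succ y z) = gr_succ (gr_succ x y) z + gr_succ (gr_prec x y) z.
Proof.
rewrite -[x]gr_reprK -[y]gr_reprK -[z]gr_reprK.
move: (gr_repr x) (gr_repr y) (gr_repr z) => u v w.
rewrite !(gr_pi_succ, gr_pi_prec) -gr_piD; congr gr_pi.
apply: val_inj; apply/funext => n.
rewrite -[LHS]/(conv_fun _ u (conv_fun _ v w) n).
rewrite -[RHS]/(conv_fun _ (conv_fun _ u v) w n + conv_fun _ (conv_fun _ u v) w n).
rewrite !(conv_funAr _ _ _ _ _ (@presuccPr k P)) !(conv_funAl _ _ _ _ _ (@presuccPl k P)).
rewrite -big_split; apply: eq_bigr => i _; rewrite -big_split.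
by apply: eq_bigr => j _; apply: presucc_succ.
Qed.

Fact gr_succ_prec (x y z : gr) :
  gr_succ x (gr_prec y z) = gr_prec (gr_succ x y) z.
Proof.
rewrite -[x]gr_reprK -[y]gr_reprK -[z]gr_reprK.
move: (gr_repr x) (gr_repr y) (gr_repr z) => u v w.
rewrite !(gr_pi_succ, gr_pi_prec); congr gr_pi.
apply: val_inj; apply/funext => n.
rewrite -[LHS]/(conv_fun _ u (conv_fun _ v w) n).
rewrite -[RHS]/(conv_fun _ (conv_fun _ u v) w n).
rewrite !(conv_funAr _ _ _ _ _ (@presuccPr k P)) !(conv_funAl _ _ _ _ _ (@preprecPl k P)).
by apply: eq_bigr => i _; apply: eq_bigr => j _; apply: presucc_prec.
Qed.

Fact gr_prec_prec (x y z : gr) :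
  gr_prec x (gr_succ y z) + gr_prec x (gr_prec y z) = gr_prec (gr_prec x y) z.
Proof.
rewrite -[x]gr_reprK -[y]gr_reprK -[z]gr_reprK.
move: (gr_repr x) (gr_repr y) (gr_repr z) => u v w.
rewrite !(gr_pi_succ, gr_pi_prec) -gr_piD; congr gr_pi.
apply: val_inj; apply/funext => n.
rewrite -[LHS]/(conv_fun _ u (conv_fun _ v w) n + conv_fun _ u (conv_fun _ v w) n).
rewrite -[RHS]/(conv_fun _ (conv_fun _ u v) w n).
rewrite !(conv_funAr _ _ _ _ _ (@preprecPr k P)) !(conv_funAl _ _ _ _ _ (@preprecPl k P)).
rewrite -big_split; apply: eq_bigr => i _; rewrite -big_split.
by apply: eq_bigr => j _; apply: preprec_prec.
Qed.

HB.instance Definition _ := @Lmodule_isPreAs.Build k gr gr_succ gr_prec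
  gr_succPl gr_succPr gr_precPl gr_precPr
  gr_succ_succ gr_succ_prec gr_prec_prec.
End AssociatedGraded.

(* Universal envelopes exist: formal terms modulo the congruence generated by
   the axioms of pre-associative algebras and by the relations of A. *)
Section Existence.
Variables (k : fieldType) (A : assocType k).

Inductive term : Type :=
| TGen of A
| TZero
| TAdd of term & term
| TScale of k & term
| TSucc of term & term
| TPrec of term & term.

HB.instance Definition _ := gen_eqMixin term.
HB.instance Definition _ := gen_choiceMixin term.

Inductive teq : term -> term -> Prop :=
| teq_refl s : teq s s
| teq_sym s t : teq s t -> teq t s
| teq_trans s t u : teq s t -> teq t u -> teq s u
| teq_add s s' t t' : teq s s' -> teq t t' -> teq (TAdd s t) (TAdd s' t')
| teq_scale a s s' : teq s s' -> teq (TScale a s) (TScale a s')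
| teq_succ s s' t t' : teq s s' -> teq t t' -> teq (TSucc s t) (TSucc s' t')
| teq_prec s s' t t' : teq s s' -> teq t t' -> teq (TPrec s t) (TPrec s' t')
| teq_addA s t u : teq (TAdd s (TAdd t u)) (TAdd (TAdd s t) u)
| teq_addC s t : teq (TAdd s t) (TAdd t s)
| teq_add0 s : teq (TAdd TZero s) s
| teq_addN s : teq (TAdd (TScale (-1) s) s) TZero
| teq_scaleA a b s : teq (TScale a (TScale b s)) (TScale (a * b) s)
| teq_scale1 s : teq (TScale 1 s) s
| teq_scaleDr a s t : teq (TScale a (TAdd s t)) (TAdd (TScale a s) (TScale a t))
| teq_scaleDl a b s : teq (TScale (a + b) s) (TAdd (TScale a s) (TScale b s))
| teq_succPl a s t u : teq (TSucc (TAdd (TScale a s) t) u)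
    (TAdd (TScale a (TSucc s u)) (TSucc t u))
| teq_succPr a s t u : teq (TSucc u (TAdd (TScale a s) t))
    (TAdd (TScale a (TSucc u s)) (TSucc u t))
| teq_precPl a s t u : teq (TPrec (TAdd (TScale a s) t) u)
    (TAdd (TScale a (TPrec s u)) (TPrec t u))
| teq_precPr a s t u : teq (TPrec u (TAdd (TScale a s) t))
    (TAdd (TScale a (TPrec u s)) (TPrec u t))
| teq_succ_succ s t u : teq (TSucc s (TSucc t u))
    (TAdd (TSucc (TSucc s t) u) (TSucc (TPrec s t) u))
| teq_succ_prec s t u : teq (TSucc s (TPrec t u)) (TPrec (TSucc s t) u)
| teq_prec_prec s t u : teq (TAdd (TPrec s (TSucc t u)) (TPrec s (TPrec t u)))
    (TPrec (TPrec s t) u)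
| teq_lin a x y : teq (TGen (a *: x + y)) (TAdd (TScale a (TGen x)) (TGen y))
| teq_mul x y : teq (TGen (x ⋅ y))
    (TAdd (TSucc (TGen x) (TGen y)) (TPrec (TGen x) (TGen y))).

Definition teqb (s t : term) : bool := `[< teq s t >].
Fact teqb_equiv : equiv_class_of teqb.
Proof.
split=> [s|s t|t s u]; first by apply/asboolP/teq_refl.
  by apply/asboolP/asboolP; apply: teq_sym.
by move=> /asboolP st /asboolP tu; apply/asboolP; apply: teq_trans st tu.
Qed.
Canonical teqb_equiv_rel := EquivRelPack teqb_equiv.
Canonical teqb_encModRel := defaultEncModRel teqb.

Definition envelope : Type := {eq_quot teqb}.
HB.instance Definition _ := Choice.on envelope.

Definition env_pi (s : term) : envelope := \pi_({eq_quot teqb}) s.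
Definition env_repr (x : envelope) : term := repr (x : {eq_quot teqb}).

Lemma env_reprK : cancel env_repr env_pi. Proof. exact: reprK. Qed.
Lemma env_piP s t : env_pi s = env_pi t <-> teq s t.
Proof.
by split=> [/eqmodP/asboolP|st]; last by apply/eqmodP/asboolP.
Qed.
Lemma env_pi_repr s : teq (env_repr (env_pi s)) s.
Proof. by apply/env_piP; rewrite env_reprK. Qed.

Definition env_add x y := env_pi (TAdd (env_repr x) (env_repr y)).
Definition env_scale a x := env_pi (TScale a (env_repr x)).
Definition env_succ x y := env_pi (TSucc (env_repr x) (env_repr y)).
Definition env_prec x y := env_pi (TPrec (env_repr x) (env_repr y)).

Lemma env_piD s t : env_add (env_pi s) (env_pi t) = env_pi (TAdd s t).
Proof. by apply/env_piP/teq_add; apply: env_pi_repr. Qed.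
Lemma env_piZ a s : env_scale a (env_pi s) = env_pi (TScale a s).
Proof. by apply/env_piP/teq_scale/env_pi_repr. Qed.
Lemma env_pi_succ s t : env_succ (env_pi s) (env_pi t) = env_pi (TSucc s t).
Proof. by apply/env_piP/teq_succ; apply: env_pi_repr. Qed.
Lemma env_pi_prec s t : env_prec (env_pi s) (env_pi t) = env_pi (TPrec s t).
Proof. by apply/env_piP/teq_prec; apply: env_pi_repr. Qed.
Let env_piE := (env_piD, env_piZ, env_pi_succ, env_pi_prec).

Fact env_addA : associative env_add.
Proof.
move=> x y z; rewrite -[x]env_reprK -[y]env_reprK -[z]env_reprK !env_piE.
exact/env_piP/teq_addA.
Qed.
Fact env_addC : commutative env_add.
Proof.
by move=> x y; rewrite -[x]env_reprK -[y]env_reprK !env_piE; apply/env_piP/teq_addC.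
Qed.
Fact env_add0 : left_id (env_pi TZero) env_add.
Proof. by move=> x; rewrite -[x]env_reprK !env_piE; apply/env_piP/teq_add0. Qed.
Fact env_addN : left_inverse (env_pi TZero) (env_scale (-1)) env_add.
Proof. by move=> x; rewrite -[x]env_reprK !env_piE; apply/env_piP/teq_addN. Qed.
HB.instance Definition _ :=
  GRing.isZmodule.Build envelope env_addA env_addC env_add0 env_addN.

Fact env_scaleA a b x : env_scale a (env_scale b x) = env_scale (a * b) x.
Proof. by rewrite -[x]env_reprK !env_piE; apply/env_piP/teq_scaleA. Qed.
Fact env_scale1 : left_id 1 env_scale.
Proof. by move=> x; rewrite -[x]env_reprK !env_piE; apply/env_piP/teq_scale1. Qed.
Fact env_scaleDr : right_distributive env_scale env_add.
Proof.
move=> a x y; rewrite -[x]env_reprK -[y]env_reprK !env_piE.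
exact/env_piP/teq_scaleDr.
Qed.
Fact env_scaleDl x a b :
  env_scale (a + b) x = env_add (env_scale a x) (env_scale b x).
Proof. by rewrite -[x]env_reprK !env_piE; apply/env_piP/teq_scaleDl. Qed.
HB.instance Definition _ := GRing.Zmodule_isLmodule.Build k envelope
  env_scaleA env_scale1 env_scaleDr env_scaleDl.

Fact env_succPl (a : k) x y z : env_succ (env_add (env_scale a x) y) z
  = env_add (env_scale a (env_succ x z)) (env_succ y z).
Proof.
rewrite -[x]env_reprK -[y]env_reprK -[z]env_reprK !env_piE.
exact/env_piP/teq_succPl.
Qed.
Fact env_succPr (a : k) x y z : env_succ z (env_add (env_scale a x) y)
  = env_add (env_scale a (env_succ z x)) (env_succ z y).
Proof.
rewrite -[x]env_reprK -[y]env_reprK -[z]env_reprK !env_piE.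
exact/env_piP/teq_succPr.
Qed.
Fact env_precPl (a : k) x y z : env_prec (env_add (env_scale a x) y) z
  = env_add (env_scale a (env_prec x z)) (env_prec y z).
Proof.
rewrite -[x]env_reprK -[y]env_reprK -[z]env_reprK !env_piE.
exact/env_piP/teq_precPl.
Qed.
Fact env_precPr (a : k) x y z : env_prec z (env_add (env_scale a x) y)
  = env_add (env_scale a (env_prec z x)) (env_prec z y).
Proof.
rewrite -[x]env_reprK -[y]env_reprK -[z]env_reprK !env_piE.
exact/env_piP/teq_precPr.
Qed.
Fact env_succ_succ x y z : env_succ x (env_succ y z)
  = env_add (env_succ (env_succ x y) z) (env_succ (env_prec x y) z).
Proof.
rewrite -[x]env_reprK -[y]env_reprK -[z]env_reprK !env_piE.
exact/env_piP/teq_succ_succ.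
Qed.
Fact env_succ_prec x y z : env_succ x (env_prec y z) = env_prec (env_succ x y) z.
Proof.
rewrite -[x]env_reprK -[y]env_reprK -[z]env_reprK !env_piE.
exact/env_piP/teq_succ_prec.
Qed.
Fact env_prec_prec x y z : env_add (env_prec x (env_succ y z))
  (env_prec x (env_prec y z)) = env_prec (env_prec x y) z.
Proof.
rewrite -[x]env_reprK -[y]env_reprK -[z]env_reprK !env_piE.
exact/env_piP/teq_prec_prec.
Qed.
HB.instance Definition _ := @Lmodule_isPreAs.Build k envelope env_succ env_prec
  env_succPl env_succPr env_precPl env_precPr
  env_succ_succ env_succ_prec env_prec_prec.

Definition env_iota (x : A) : envelope := env_pi (TGen x).

Section Eval.
Variables (P : preAsType k) (f : A -> P).
Fixpoint teval (s : term) : P :=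
  match s with
  | TGen x => f x
  | TZero => 0
  | TAdd s t => teval s + teval t
  | TScale a s => a *: teval s
  | TSucc s t => teval s ≻ teval t
  | TPrec s t => teval s ≺ teval t
  end.
Hypothesis fh : assoc_hom (f : A -> plus_alg P).
Lemma teval_teq s t : teq s t -> teval s = teval t.
Proof.
have [fl fm] := fh.
elim=> //=.
- by move=> {}s {}t u _ -> _ ->.
- by move=> {}s s' {}t t' _ -> _ ->.
- by move=> a {}s s' _ ->.
- by move=> {}s s' {}t t' _ -> _ ->.
- by move=> {}s s' {}t t' _ -> _ ->.
- by move=> *; rewrite addrA.
- by move=> *; rewrite addrC.
- by move=> *; rewrite add0r.
- by move=> *; rewrite scaleN1r addNr.
- by move=> *; rewrite scalerA.
- by move=> *; rewrite scale1r.
- by move=> *; rewrite scalerDr.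
- by move=> *; rewrite scalerDl.
- by move=> *; rewrite presuccPl.
- by move=> *; rewrite presuccPr.
- by move=> *; rewrite preprecPl.
- by move=> *; rewrite preprecPr.
- by move=> *; rewrite presucc_succ.
- by move=> *; rewrite presucc_prec.
- by move=> *; rewrite preprec_prec.
Qed.
End Eval.

Theorem envelope_universal : universal_envelope env_iota.
Proof.
split.
- split=> [a x y|x y].
    rewrite -[RHS]/(env_add (env_scale a (env_pi _)) (env_pi _)) !env_piE.
    exact/env_piP/teq_lin.
  rewrite -[RHS]/(env_add (env_succ (env_pi _) (env_pi _))
    (env_prec (env_pi _) (env_pi _))) !env_piE.
  exact/env_piP/teq_mul.
- move=> S [S0 SP Ss Sp] Sg x; rewrite -[x]env_reprK.
  have SD u v : S u -> S v -> S (u + v).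
    by move=> Su Sv; rewrite -[u]scale1r; apply: SP.
  elim: (env_repr x) => [y||s IHs t IHt|a s IHs|s IHs t IHt|s IHs t IHt].
  + exact: Sg.
  + exact: S0.
  + by rewrite -env_piD; apply: SD.
  + by rewrite -env_piZ -[env_scale _ _]addr0; apply: (SP a).
  + by rewrite -env_pi_succ; apply: Ss.
  + by rewrite -env_pi_prec; apply: Sp.
move=> P f fh.
have E s : teval (f : A -> P) (env_repr (env_pi s)) = teval (f : A -> P) s.
  exact/teval_teq/env_pi_repr.
exists (fun x => teval (f : A -> P) (env_repr x)).
  split=> [a x y|x y|x y]; rewrite -[x]env_reprK -[y]env_reprK.
  - by rewrite -[_ + _ in LHS]/(env_add (env_scale a (env_pi _)) (env_pi _)) !env_piE !E.
  - by rewrite -[_ ≻ _ in LHS]/(env_succ _ _) env_pi_succ !E.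
  - by rewrite -[_ ≺ _ in LHS]/(env_prec _ _) env_pi_prec !E.
by move=> a; rewrite [env_iota a]/env_iota E.
Qed.
End Existence.

(* Main.v *)
Require Import Defs.
From HB Require Import structures.
From mathcomp Require Import all_boot all_algebra wochoice.
From mathcomp Require Import ring zify.
From mathcomp Require Import generic_quotient ring_quotient boolp functions.

(* In terms of ∗ and ≻ the axioms of a pre-associative algebra say that ∗ is
   associative, x ≻ (y ≻ z) = (x ∗ y) ≻ z, and
   (x ≻ y) ∗ z = (x ≻ y) ≻ z + x ≻ (y ∗ z) - (x ∗ y) ≻ z.
   Folding the right spine of a reduced word of length > 1 with the first
   equation turns it into q ≻ i, with q a normal form and i a letter. So normal
   forms are trees, built from the letters by q ≻ i and p ∗ (q ≻ i). The
   identities determine the products of trees recursively, and conversely these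
   recursive formulas define a pre-associative algebra on the free module on
   trees, which has the universal property of the envelope. The products do not
   raise the degree of trees, so the natural filtration is the degree
   filtration, and the homomorphism from U_*(A^(0)) to gr U_*(A) given by the
   universal property maps the basis of trees to the basis of trees. *)

Set Implicit Arguments.
Unset Strict Implicit.
Unset Printing Implicit Defensive.

Import GRing.Theory.
Local Open Scope ring_scope.

(** * Bases and free modules *)

Section LinearMaps.
Variables (k : fieldType) (V W : lmodType k).

Lemma lin_fun0 (f : V -> W) : linear f -> f 0 = 0.
Proof.
by move=> fl; have := fl (-1) 0 0; rewrite scaler0 addr0 scaleN1r addNr.
Qed.

Lemma lin_fun_sum (f : V -> W) (I : Type) (r : seq I) (c : I -> k) (v : I -> V) :
  linear f -> f (\sum_(i <- r) c i *: v i) = \sum_(i <- r) c i *: f (v i).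
Proof.
move=> fl; elim: r => [|i r IH]; first by rewrite !big_nil lin_fun0.
by rewrite !big_cons fl IH.
Qed.
End LinearMaps.

Section BilinearOpp.
Variables (k : fieldType) (U V W : lmodType k) (f : U -> V -> W).
Hypothesis fl : forall (a : k) x y z, f (a *: x + y) z = a *: f x z + f y z.
Hypothesis fr : forall (a : k) x y z, f z (a *: x + y) = a *: f z x + f z y.

Lemma bilNl x z : f (- x) z = - f x z.
Proof. by rewrite -[- x]add0r (bilBl fl) (bil0l fl) add0r. Qed.
Lemma bilNr x z : f z (- x) = - f z x.
Proof. by rewrite -[- x]add0r (bilBr fr) (bil0r fr) add0r. Qed.
End BilinearOpp.

Section Bases.
Variables (k : fieldType) (V : lmodType k) (I : choiceType) (b : I -> V).
Hypothesis bb : lin_basis b.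

Lemma basis_ind (S : V -> Prop) :
  S 0 -> (forall (a : k) u v, S u -> S v -> S (a *: u + v)) ->
  (forall i, S (b i)) -> forall v, S v.
Proof.
move=> S0 SP Sb v; have [n [t [c ->]]] := bb.2 v.
by elim/big_rec: _ => // i u _; apply: SP.
Qed.

Lemma basis_eq (W : lmodType k) (f g : V -> W) :
  linear f -> linear g -> (forall i, f (b i) = g (b i)) -> f =1 g.
Proof.
move=> fl gl fg; apply: basis_ind => //.
  by rewrite (lin_fun0 fl) (lin_fun0 gl).
by move=> a u v fu fv; rewrite fl gl fu fv.
Qed.

Lemma basis_free_seq (s : seq I) (c : I -> k) : uniq s ->
  \sum_(i <- s) c i *: b i = 0 -> forall i, i \in s -> c i = 0.
Proof.
move=> us; rewrite big_tnth => s0 i si.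
have [j ->] : exists j, i = tnth (in_tuple s) j by apply/tnthP.
apply: (bb.1 _ (tnth (in_tuple s)) (fun j => c (tnth (in_tuple s) j))) => //.
exact/tuple_uniqP.
Qed.

(** Indices may repeat in [r]. Collecting the terms of equal index gives a relation between distinct
    basis vectors, whose coefficients [d j] vanish, and the same collection applies to [f]. This is
    what makes linear extension independent of the chosen representation. *)
Lemma basis_rel (W : lmodType k) (f : I -> W) (r : seq (k * I)) :
  \sum_(p <- r) p.1 *: b p.2 = 0 -> \sum_(p <- r) p.1 *: f p.2 = 0.
Proof.
pose s := undup [seq p.2 | p <- r].
pose d j := \sum_(p <- r | p.2 == j) p.1.
have E (W' : lmodType k) (f' : I -> W') :
    \sum_(p <- r) p.1 *: f' p.2 = \sum_(j <- s) d j *: f' j.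
  transitivity (\sum_(j <- s) \sum_(p <- r | p.2 == j) p.1 *: f' p.2).
    rewrite (exchange_big_dep xpredT) //= [LHS]big_seq [RHS]big_seq.
    apply: eq_bigr => p rp.
    rewrite big_mkcond (bigD1_seq p.2) ?undup_uniq //=; last first.
      by rewrite mem_undup; apply: map_f.
    by rewrite eqxx [X in _ + X]big1 ?addr0 // => j jp; rewrite ifN_eqC.
  apply: eq_bigr => j _; rewrite scaler_suml; apply: eq_bigr => p.
  by move=> /eqP ->.
rewrite !E => /(basis_free_seq (undup_uniq _)) d0.
by rewrite big_seq big1 // => j /d0 ->; rewrite scale0r.
Qed.

Lemma basis_extend (W : lmodType k) (f : I -> W) :
  exists2 g : V -> W, linear g & forall i, g (b i) = f i.
Proof.
have rep v : {r : seq (k * I) | v = \sum_(p <- r) p.1 *: b p.2}.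
  apply: cid; have [n [t [c ->]]] := bb.2 v.
  by exists [seq (c i, t i) | i <- index_enum 'I_n]; rewrite big_map.
pose g v := \sum_(p <- sval (rep v)) p.1 *: f p.2.
have gE r v : v = \sum_(p <- r) p.1 *: b p.2 -> g v = \sum_(p <- r) p.1 *: f p.2.
  have vE := svalP (rep v); move=> vr; apply/eqP; rewrite -subr_eq0; apply/eqP.
  (* Two representations of [v], one with reversed signs, form a single relation in [b], which
     [basis_rel] carries over to [f]. *)
  pose r' := sval (rep v) ++ [seq (- p.1, p.2) | p <- r].
  have E (W' : lmodType k) (f' : I -> W') : \sum_(p <- r') p.1 *: f' p.2 =
      \sum_(p <- sval (rep v)) p.1 *: f' p.2 - \sum_(p <- r) p.1 *: f' p.2.
    rewrite big_cat big_map; congr (_ + _); rewrite -sumrN.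
    by apply: eq_bigr => p _; rewrite scaleNr.
  by rewrite -E; apply: basis_rel; rewrite E -vE -vr subrr.
exists g => [a u v|i]; last first.
  by rewrite (gE [:: (1, i)]) big_seq1 scale1r.
rewrite (gE ([seq (a * p.1, p.2) | p <- sval (rep u)] ++ sval (rep v))).
  rewrite big_cat big_map scaler_sumr; congr (_ + _).
  by apply: eq_bigr => p _; rewrite scalerA.
rewrite big_cat big_map -(svalP (rep v)); congr (_ + _).
rewrite [in LHS](svalP (rep u)) scaler_sumr.
by apply: eq_bigr => p _; rewrite scalerA.
Qed.

Definition lin_ext (W : lmodType k) (f : I -> W) : V -> W :=
  s2val (cid2 (basis_extend f)).

Lemma lin_ext_linear (W : lmodType k) (f : I -> W) : linear (lin_ext f).
Proof. by rewrite /lin_ext; case: cid2. Qed.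

Lemma lin_extE (W : lmodType k) (f : I -> W) i : lin_ext f (b i) = f i.
Proof. by rewrite /lin_ext; case: cid2. Qed.

(** Operations of several arguments are built below by nesting [lin_ext]; this gives their linearity
    in the inner arguments. *)
Lemma lin_ext_lin (W : lmodType k) (a : k) (f g : I -> W) v :
  lin_ext (fun i => a *: f i + g i) v = a *: lin_ext f v + lin_ext g v.
Proof.
move: v; apply: basis_eq => [|c u v|i]; first exact: lin_ext_linear.
  by rewrite !lin_ext_linear !scalerDr !scalerA mulrC addrACA.
by rewrite !lin_extE.
Qed.
End Bases.

Lemma bilinear_eq (k : fieldType) (U V W : lmodType k) (I J : choiceType)
    (b : I -> U) (d : J -> V) (f g : U -> V -> W) :
  lin_basis b -> lin_basis d ->
  (forall (a : k) x y z, f (a *: x + y) z = a *: f x z + f y z) ->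
  (forall (a : k) x y z, f z (a *: x + y) = a *: f z x + f z y) ->
  (forall (a : k) x y z, g (a *: x + y) z = a *: g x z + g y z) ->
  (forall (a : k) x y z, g z (a *: x + y) = a *: g z x + g z y) ->
  (forall i j, f (b i) (d j) = g (b i) (d j)) -> forall u v, f u v = g u v.
Proof.
move=> bb db fl fr gl gr E u v; move: u.
apply: (basis_eq bb) => [c u1 u2|c u1 u2|i] //.
by move: v; apply: (basis_eq db) => [c v1 v2|c v1 v2|j].
Qed.

Lemma lin_basis_bij (k : fieldType) (V W : lmodType k) (I J : Type)
    (b : I -> V) (f : V -> W) (h : J -> I) :
  lin_basis b -> linear f -> bijective f -> bijective h ->
  lin_basis (fun j => f (b (h j))).
Proof.
move=> [bi bs] fl fb [h' hK h'K]; split=> [n t c ti|w].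
  move=> s0; apply: (bi _ (h \o t)).
    by apply: inj_comp ti; apply: can_inj hK.
  by apply: (bij_inj fb); rewrite lin_fun_sum // (lin_fun0 fl).
have [g fK gK] := fb; have [n [t [c E]]] := bs (g w).
exists n, (h' \o t), c; rewrite -[w]gK E lin_fun_sum //.
by apply: eq_bigr => i _ /=; rewrite h'K.
Qed.

Section FreeModule.
Variables (k : fieldType) (T : choiceType).

Definition finsupp_pred : {pred T -> k^o} :=
  fun f => `[< exists s : seq T, forall t, t \notin s -> f t = 0 >].

Fact finsupp_pred_closed : submod_closed finsupp_pred.
Proof.
split; first by apply/asboolP; exists [::].
move=> a f g /asboolP[s fs] /asboolP[s' gs]; apply/asboolP.
exists (s ++ s') => t; rewrite mem_cat negb_or => /andP[ts ts'].
by rewrite -[LHS]/(a * f t + g t) fs // gs // mulr0 addr0.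
Qed.
HB.instance Definition _ :=
  GRing.isSubmodClosed.Build k (T -> k^o) finsupp_pred finsupp_pred_closed.

Record fmod := Fmod { fmod_fun : T -> k^o; _ : fmod_fun \in finsupp_pred }.
HB.instance Definition _ := [isSub for fmod_fun].
HB.instance Definition _ := [Choice of fmod by <:].
HB.instance Definition _ := [SubChoice_isSubLmodule of fmod by <:].

Fact delta_subproof t : (fun t' => (t' == t)%:R) \in finsupp_pred.
Proof.
by apply/asboolP; exists [:: t] => t'; rewrite inE => /negPf ->.
Qed.
Definition delta t : fmod := Fmod (delta_subproof t).

Definition fcoef (u : fmod) (t : T) : k := fmod_fun u t.

Lemma fmodP (u v : fmod) : fcoef u =1 fcoef v -> u = v.
Proof. by move=> uv; apply: val_inj; apply/funext. Qed.

Lemma fcoefP (a : k) (u v : fmod) t :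
  fcoef (a *: u + v) t = a * fcoef u t + fcoef v t.
Proof. by []. Qed.
Lemma fcoef0 t : fcoef 0 t = 0. Proof. by []. Qed.
Lemma fcoefD (u v : fmod) t : fcoef (u + v) t = fcoef u t + fcoef v t.
Proof. by []. Qed.
Lemma fcoefN (u : fmod) t : fcoef (- u) t = - fcoef u t.
Proof. by []. Qed.
Lemma fcoefZ (a : k) (u : fmod) t : fcoef (a *: u) t = a * fcoef u t.
Proof. by []. Qed.
Lemma fcoef_delta t t' : fcoef (delta t) t' = (t' == t)%:R.
Proof. by []. Qed.
Lemma fcoef_sum (J : Type) (r : seq J) (u : J -> fmod) t :
  fcoef (\sum_(j <- r) u j) t = \sum_(j <- r) fcoef (u j) t.
Proof. exact: (big_morph (fun u => fcoef u t)). Qed.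

Lemma fmod_sum (u : fmod) : exists2 s : seq T, uniq s &
  u = \sum_(t <- s) fcoef u t *: delta t.
Proof.
have /asboolP[s fs] := valP u; exists (undup s); first exact: undup_uniq.
apply: fmodP => t; rewrite fcoef_sum.
under eq_bigr do rewrite fcoefZ fcoef_delta.
have [ts|ts] := boolP (t \in undup s).
  rewrite (bigD1_seq t) ?undup_uniq //= eqxx mulr1 big1 ?addr0 // => j jt.
  by rewrite eq_sym (negPf jt) mulr0.
rewrite big_seq big1 => [|j js]; first by apply: fs; rewrite -mem_undup.
by rewrite (_ : (t == j) = false) ?mulr0 //; apply: contraNF ts => /eqP ->.
Qed.

Lemma delta_basis : lin_basis delta.
Proof.
split=> [n t c ti s0 i|u].
  have : fcoef (\sum_(i < n) c i *: delta (t i)) (t i) = 0 by rewrite s0.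
  rewrite fcoef_sum.
  under eq_bigr do rewrite fcoefZ fcoef_delta.
  rewrite (bigD1 i) //= eqxx mulr1 big1 ?addr0 // => j ji.
  by rewrite (inj_eq ti) eq_sym (negPf ji) mulr0.
have [s _ ->] := fmod_sum u; set c := fcoef u.
exists (size s), (tnth (in_tuple s)), (fun i => c (tnth (in_tuple s) i)).
by rewrite big_tnth.
Qed.
End FreeModule.

(** * Existence of a basis, by well-ordering *)

Section BasisExistence.
Variables (k : fieldType) (V : lmodType k).

Lemma well_order_max (I : eqType) (R : rel I) (s : seq I) :
  well_order R -> s != [::] -> exists2 i, i \in s & {in s, forall j, R j i}.
Proof.
move=> wR; have wR' : wo_chain R predT by apply: withinW.
have tot i j : R i j || R j i by apply: (wo_chainW wR').
have anti i j : R i j -> R j i -> i = j.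
  by move=> ij ji; apply: (wo_chain_antisymmetric wR') => //; rewrite ij.
have tr : transitive R.
  move=> j i l ij jl.
  (* Transitivity comes from the least element y of {i, j, l}: y = i gives the claim at once, y = j
     forces i = j, and y = l forces j = l. *)
  have [|y [[yA ym] _]] := wR [pred y | [|| y == i, y == j | y == l]].
    by exists i; rewrite !inE eqxx.
  have [yi yj yl] : [/\ R y i, R y j & R y l].
    by split; apply: ym; rewrite !inE eqxx ?orbT.
  move: yA; rewrite !inE => /or3P[]/eqP E; subst y => //.
    by rewrite (anti i j).
  by rewrite -(anti j l).
elim: s => // i [|i' s] IH _.
  exists i; rewrite ?inE // => j; rewrite inE => /eqP ->.
  by case/orP: (tot i i).
have [//|m ms mm] := IH; have /orP[im|mi] := tot i m.
  exists m; first by rewrite in_cons ms orbT.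
    by move=> j /predU1P[->|/mm].
exists i => [|j /predU1P[->|/mm jm]]; first exact: mem_head.
  by case/orP: (tot i i).
exact: tr mi.
Qed.

(** The inductive type [span] lives on a pre-associative algebra; here [V] is a bare module. *)
Inductive lspan (S : V -> Prop) : V -> Prop :=
| lspan0 : lspan S 0
| lspanP (a : k) u v : S u -> lspan S v -> lspan S (a *: u + v).

Lemma lspan_lin (S : V -> Prop) (a : k) u v :
  lspan S u -> lspan S v -> lspan S (a *: u + v).
Proof.
move=> + Sv; elim=> [|c w w' Sw _ IH]; first by rewrite scaler0 add0r.
by rewrite scalerDr scalerA -addrA; apply: lspanP.
Qed.

Lemma span_sum (I : Type) (b : I -> V) v :
  lspan (fun u => exists i, u = b i) v ->
  exists n (t : 'I_n -> I) (c : 'I_n -> k), v = \sum_(i < n) c i *: b (t i).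
Proof.
move=> Sv; suff [r ->] : exists r : seq (k * I), v = \sum_(p <- r) p.1 *: b p.2.
  exists (size r), (fun i => (tnth (in_tuple r) i).2).
  by exists (fun i => (tnth (in_tuple r) i).1); rewrite big_tnth.
elim: Sv => [|a _ w [i ->] _ [r ->]]; first by exists [::]; rewrite big_nil.
by exists ((a, i) :: r); rewrite big_cons.
Qed.

(* The basis: the vectors that are not in the span of the smaller ones, for a
   well-order. *)
Lemma basis_exists : exists (X : choiceType) (x : X -> V), lin_basis x.
Proof.
have [R wR] := well_ordering_principle V.
have wR' : wo_chain R predT by apply: withinW.
pose below v u := R u v /\ u <> v.
pose B : {pred V} := fun v => ~~ `[< lspan (below v) v >].
exists {v | v \in B}, val; split=> [n t c ti s0|v].
  apply: contrapT => /existsNP[i0 /eqP ci0].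
  (* Independence: solving the relation for the greatest vector with nonzero coefficient puts that
     vector in the span of smaller ones, against its membership in [B]. *)
  pose s := [seq val (t i) | i <- enum 'I_n & c i != 0].
  have mems i : c i != 0 -> val (t i) \in s.
    by move=> ci; apply: map_f; rewrite mem_filter ci mem_enum.
  have [|m /mapP[j]] := well_order_max (s := s) wR.
    by apply/eqP => s_nil; have := mems _ ci0; rewrite s_nil.
  rewrite mem_filter => /andP[cj _] -> jm.
  have /asboolP[] : ~~ `[< lspan (below (val (t j))) (val (t j)) >] := valP (t j).
  have E : val (t j) = \sum_(i < n | i != j) - (c j)^-1 * c i *: val (t i).
    move: s0; rewrite (bigD1 j) //= => /eqP; rewrite addr_eq0 => /eqP s0.
    rewrite -[LHS]scale1r -(mulVf cj) -scalerA s0 scalerN -scaleNr scaler_sumr.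
    by apply: eq_bigr => i _; rewrite scalerA.
  rewrite [X in lspan _ X]E; elim/big_rec: _ => [|i u ij Su]; first exact: lspan0.
  have [ci|ci] := eqVneq (c i) 0; first by rewrite ci mulr0 scale0r add0r.
  apply: lspanP Su; split; first exact/jm/mems.
  by move=> /val_inj/ti/eqP; apply/negP.
pose spB := lspan (fun u => exists i : {v | v \in B}, u = val i).
apply: span_sum; apply: contrapT => nv.
(* Let m be the least vector outside the span of [B]. It is not in [B], so it is a combination of
   smaller vectors; by minimality these lie in the span of [B], and so does m. *)
have [|m [[/asboolP Nm mm] _]] := wR (fun u => `[< ~ spB u >]).
  by exists v; apply/asboolP.
have [mB|/negPn/asboolP] := boolP (m \in B).
  apply: Nm; rewrite -[m]scale1r -[1 *: m]addr0.
  apply: lspanP; last exact: lspan0.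
  by exists (exist _ m mB).
move=> Sm; apply: Nm; elim: Sm => [|a u w [um neq] _ IH]; first exact: lspan0.
apply: lspan_lin IH; apply: contrapT => Nu; apply: neq.
apply: (wo_chain_antisymmetric wR') => //; rewrite um mm //.
exact/asboolP.
Qed.
End BasisExistence.

(** * The pre-associative algebra of trees *)

Inductive tree (X : Type) : Type :=
| Leaf of X
| Graft of tree X & X
| Comb of tree X & tree X & X.

HB.instance Definition _ (X : Type) := gen_eqMixin (tree X).
HB.instance Definition _ (X : Type) := gen_choiceMixin (tree X).

Fixpoint tdeg X (t : tree X) : nat :=
  match t with
  | Leaf _ => 1
  | Graft q _ => (tdeg q).+1
  | Comb p q _ => (tdeg p + (tdeg q).+1)%N
  end.

Fixpoint tree_val (k : fieldType) (P : preAsType k) X (x : X -> P)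
    (t : tree X) : P :=
  match t with
  | Leaf i => x i
  | Graft q i => tree_val x q ≻ x i
  | Comb p q i => tree_val x p ∗ (tree_val x q ≻ x i)
  end.

Section PreAsIdentities.
Variables (k : fieldType) (P : preAsType k).
Implicit Types x y z : P.

Lemma succ_starl x y z : (x ∗ y) ≻ z = x ≻ (y ≻ z).
Proof. by rewrite /prestar (bilDl (@presuccPl k P)) -presucc_succ. Qed.

(** The difference of the last two terms is x ≻ (y ≺ z), so this is the middle axiom freed of ≺. *)
Lemma star_succl x y z :
  (x ≻ y) ∗ z = (x ≻ y) ≻ z + x ≻ (y ∗ z) - (x ∗ y) ≻ z.
Proof.
rewrite succ_starl [y ∗ z]/prestar (bilDr (@presuccPr k P)).
by rewrite -addrA [_ + _ - _]addrAC subrr add0r presucc_prec.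
Qed.
End PreAsIdentities.

Section Model.
Variables (k : fieldType) (A : assocType k) (X : choiceType) (x : X -> A).
Hypothesis xb : lin_basis x.

Local Notation F := (fmod k (tree X)).
Local Notation δ := (@delta k (tree X)).
Local Notation ext := (lin_ext (@delta_basis k (tree X))).

(** The constructors of trees, made multilinear: the final letter becomes any element of [A], since
    a product of two letters in [A] is in general a combination of letters. *)
Definition leaf : A -> F := lin_ext xb (fun i => δ (Leaf i)).
Definition graft (q : F) (a : A) : F :=
  ext (fun t => lin_ext xb (fun i => δ (Graft t i)) a) q.
Definition comb (p q : F) (a : A) : F :=
  ext (fun s => ext (fun t => lin_ext xb (fun i => δ (Comb s t i)) a) q) p.

Lemma leafP : linear leaf. Proof. exact: lin_ext_linear. Qed.
Lemma graftPl c u v a : graft (c *: u + v) a = c *: graft u a + graft v a.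
Proof. exact: lin_ext_linear. Qed.
Lemma graftPr c a b u : graft u (c *: a + b) = c *: graft u a + graft u b.
Proof.
rewrite /graft -lin_ext_lin; congr (ext _ u); apply/funext => t.
exact: lin_ext_linear.
Qed.
Lemma combP1 q a c u v :
  comb (c *: u + v) q a = c *: comb u q a + comb v q a.
Proof. exact: lin_ext_linear. Qed.
Lemma combP2 p a c u v :
  comb p (c *: u + v) a = c *: comb p u a + comb p v a.
Proof.
rewrite /comb -lin_ext_lin; congr (ext _ p); apply/funext => t.
exact: lin_ext_linear.
Qed.
Lemma combP3 p q c a b :
  comb p q (c *: a + b) = c *: comb p q a + comb p q b.
Proof.
rewrite /comb -lin_ext_lin; congr (ext _ p); apply/funext => s.
rewrite -lin_ext_lin; congr (ext _ q); apply/funext => t.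
exact: lin_ext_linear.
Qed.

Lemma leafE i : leaf (x i) = δ (Leaf i). Proof. exact: lin_extE. Qed.
Lemma graftE t i : graft (δ t) (x i) = δ (Graft t i).
Proof. by rewrite /graft !lin_extE. Qed.
Lemma combE s t i : comb (δ s) (δ t) (x i) = δ (Comb s t i).
Proof. by rewrite /comb !lin_extE. Qed.

(* [rho v a], [tmul] and [tsucc] are v ∗ a, ∗ and ≻ on trees; the formulas are
   those of star_succl. *)
Fixpoint rho_tree (t : tree X) (a : A) : F :=
  match t with
  | Leaf i => leaf (x i ⋅ a)
  | Graft q i => graft (δ t) a + graft (δ q) (x i ⋅ a)
      - graft (rho_tree q (x i)) a
  | Comb p q i => comb (δ p) (δ (Graft q i)) a + comb (δ p) (δ q) (x i ⋅ a)
      - comb (δ p) (rho_tree q (x i)) a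
  end.

Definition rho (v : F) (a : A) : F := ext (fun t => rho_tree t a) v.

Fixpoint mul_tree (v : F) (t : tree X) : F :=
  match t with
  | Leaf i => rho v (x i)
  | Graft q i => comb v (δ q) (x i)
  | Comb p q i => comb (mul_tree v p) (δ q) (x i)
  end.

Definition tmul (v u : F) : F := ext (mul_tree v) u.

(** The last case is [star_succl] for z = q ≻ i, solved for v ≻ (p ∗ z); its two ≻-products by z
    become grafts through x ≻ (q ≻ i) = (x ∗ q) ≻ i. *)
Fixpoint succ_tree (v : F) (t : tree X) : F :=
  match t with
  | Leaf i => graft v (x i)
  | Graft q i => graft (tmul v (δ q)) (x i)
  | Comb p q i => comb (succ_tree v p) (δ q) (x i)
      - graft (tmul (succ_tree v p) (δ q)) (x i)
      + graft (tmul v (tmul (δ p) (δ q))) (x i)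
  end.

Definition tsucc (v u : F) : F := ext (succ_tree v) u.

Local Ltac coefs :=
  apply: fmodP => ?; rewrite !(fcoefD, fcoefN, fcoefZ); ring.

Lemma rhoPl c u v a : rho (c *: u + v) a = c *: rho u a + rho v a.
Proof. exact: lin_ext_linear. Qed.

Lemma rhoPr c a b v : rho v (c *: a + b) = c *: rho v a + rho v b.
Proof.
rewrite /rho -lin_ext_lin; congr (ext _ v); apply/funext.
elim=> [i|q IHq i|p IHp q IHq i] /=.
- by rewrite amulPr leafP.
- rewrite amulPr !graftPr; coefs.
- rewrite amulPr !combP3; coefs.
Qed.


Lemma tmulPl c u v w : tmul (c *: u + v) w = c *: tmul u w + tmul v w.
Proof.
rewrite /tmul -lin_ext_lin; congr (ext _ w); apply/funext.
by elim=> [i|q IHq i|p IHp q IHq i] /=; rewrite ?IHp ?rhoPl ?combP1.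
Qed.
Lemma tmulPr c u v w : tmul w (c *: u + v) = c *: tmul w u + tmul w v.
Proof. exact: lin_ext_linear. Qed.

Lemma succPl c u v w : tsucc (c *: u + v) w = c *: tsucc u w + tsucc v w.
Proof.
rewrite /tsucc -lin_ext_lin; congr (ext _ w); apply/funext.
elim=> [i|q IHq i|p IHp q IHq i] /=; rewrite ?IHp ?tmulPl ?graftPl ?combP1 //.
coefs.
Qed.
Lemma succPr c u v w : tsucc w (c *: u + v) = c *: tsucc w u + tsucc w v.
Proof. exact: lin_ext_linear. Qed.

Let linE := (leafP, graftPl, graftPr, combP1, combP2, combP3,
  rhoPl, rhoPr, tmulPl, tmulPr, succPl, succPr, @amulPl k A, @amulPr k A).

Local Ltac lin := repeat intro; rewrite ?linE //; coefs.

(** Phrased with arbitrary elements instead of trees and letters, so that the inductions below can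
    use the multilinear recursion formulas directly. *)
Lemma model_ind (S : F -> Prop) :
  S 0 -> (forall (c : k) u v, S u -> S v -> S (c *: u + v)) ->
  (forall a, S (leaf a)) -> (forall q a, S q -> S (graft q a)) ->
  (forall p q a, S p -> S q -> S (comb p q a)) -> forall v, S v.
Proof.
move=> S0 SP Sl Sg Sc; apply: (basis_ind (@delta_basis k _)) => //.
elim=> [i|q IHq i|p IHp q IHq i].
- by rewrite -leafE.
- by rewrite -graftE; apply: Sg.
- by rewrite -combE; apply: Sc.
Qed.

Lemma model_eq (V : lmodType k) (f g : F -> V) : linear f -> linear g ->
  (forall a, f (leaf a) = g (leaf a)) ->
  (forall q a, f q = g q -> f (graft q a) = g (graft q a)) ->
  (forall p q a, f p = g p -> f q = g q -> f (comb p q a) = g (comb p q a)) ->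
  f =1 g.
Proof.
move=> fl gl El Eg Ec; apply: model_ind => //.
  by rewrite (lin_fun0 fl) (lin_fun0 gl).
by move=> c u v fu fv; rewrite fl gl fu fv.
Qed.

Lemma leaf_ext (V : lmodType k) (f g : A -> V) : linear f -> linear g ->
  (forall i, f (x i) = g (x i)) -> f =1 g.
Proof. exact: (basis_eq xb). Qed.

Lemma graft_ext (V : lmodType k) (f g : F -> A -> V) :
  (forall (c : k) u v a, f (c *: u + v) a = c *: f u a + f v a) ->
  (forall (c : k) a b u, f u (c *: a + b) = c *: f u a + f u b) ->
  (forall (c : k) u v a, g (c *: u + v) a = c *: g u a + g v a) ->
  (forall (c : k) a b u, g u (c *: a + b) = c *: g u a + g u b) ->
  (forall t i, f (δ t) (x i) = g (δ t) (x i)) -> forall u a, f u a = g u a.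
Proof.
move=> f1 f2 g1 g2 E; exact: (@bilinear_eq _ _ _ _ _ _ _ _ f g
  (@delta_basis k (tree X)) xb f1 f2 g1 g2 E).
Qed.

Lemma comb_ext (V : lmodType k) (f g : F -> F -> A -> V) :
  (forall (c : k) u v q a, f (c *: u + v) q a = c *: f u q a + f v q a) ->
  (forall (c : k) u v p a, f p (c *: u + v) a = c *: f p u a + f p v a) ->
  (forall (c : k) a b p q, f p q (c *: a + b) = c *: f p q a + f p q b) ->
  (forall (c : k) u v q a, g (c *: u + v) q a = c *: g u q a + g v q a) ->
  (forall (c : k) u v p a, g p (c *: u + v) a = c *: g p u a + g p v a) ->
  (forall (c : k) a b p q, g p q (c *: a + b) = c *: g p q a + g p q b) ->
  (forall s t i, f (δ s) (δ t) (x i) = g (δ s) (δ t) (x i)) ->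
  forall p q a, f p q a = g p q a.
Proof.
move=> f1 f2 f3 g1 g2 g3 E p q a.
apply: (@basis_eq _ _ _ _ (@delta_basis k (tree X)) _
  (fun p => f p q a) (fun p => g p q a)) => [c u v|c u v|s].
- exact: f1.
- exact: g1.
by apply: (@graft_ext _ (f (δ s)) (g (δ s))) => *; rewrite ?f2 ?f3 ?g2 ?g3.
Qed.

(** Here and in the next eight lemmas the defining recursions pass from trees and letters to
    arbitrary arguments, because both sides are multilinear. *)
Lemma rho_leaf b a : rho (leaf b) a = leaf (b ⋅ a).
Proof.
move: b; apply: leaf_ext => [||i]; [lin|lin|].
by rewrite leafE /rho lin_extE.
Qed.

Lemma rho_graft q b a : rho (graft q b) a =
  graft (graft q b) a + graft q (b ⋅ a) - graft (rho q b) a.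
Proof.
move: q b; apply: graft_ext => [||||t i]; [lin|lin|lin|lin|].
by rewrite graftE /rho !lin_extE.
Qed.

Lemma rho_comb p q b a : rho (comb p q b) a =
  comb p (graft q b) a + comb p q (b ⋅ a) - comb p (rho q b) a.
Proof.
move: p q b; apply: comb_ext => [||||||s t i]; [lin|lin|lin|lin|lin|lin|].
by rewrite combE graftE /rho !lin_extE.
Qed.

Lemma mul_leaf v a : tmul v (leaf a) = rho v a.
Proof.
move: a; apply: leaf_ext => [||i]; [lin|lin|].
by rewrite leafE /tmul lin_extE.
Qed.

Lemma mul_graft v q a : tmul v (graft q a) = comb v q a.
Proof.
move: q a; apply: graft_ext => [||||t i]; [lin|lin|lin|lin|].
by rewrite graftE /tmul lin_extE.
Qed.

Lemma mul_comb v p q a : tmul v (comb p q a) = comb (tmul v p) q a.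
Proof.
move: p q a; apply: comb_ext => [||||||s t i]; [lin|lin|lin|lin|lin|lin|].
by rewrite combE /tmul !lin_extE.
Qed.

Lemma succ_leaf v a : tsucc v (leaf a) = graft v a.
Proof.
move: a; apply: leaf_ext => [||i]; [lin|lin|].
by rewrite leafE /tsucc lin_extE.
Qed.

Lemma succ_graft v q a : tsucc v (graft q a) = graft (tmul v q) a.
Proof.
move: q a; apply: graft_ext => [||||t i]; [lin|lin|lin|lin|].
by rewrite graftE /tsucc lin_extE.
Qed.

Lemma succ_comb v p q a : tsucc v (comb p q a) =
  comb (tsucc v p) q a - graft (tmul (tsucc v p) q) a
    + graft (tmul v (tmul p q)) a.
Proof.
move: p q a; apply: comb_ext => [||||||s t i]; [lin|lin|lin|lin|lin|lin|].
by rewrite combE /tsucc !lin_extE.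
Qed.

Let opE := (rho_leaf, rho_graft, rho_comb, mul_leaf, mul_graft, mul_comb,
  succ_leaf, succ_graft, succ_comb).
Let distrE := (bilDl graftPl, bilNl graftPl, bilDr graftPr, bilNr graftPr,
  bilDl rhoPl, bilNl rhoPl,
  bilDr tmulPr, bilNr tmulPr, bilDl tmulPl, bilNl tmulPl,
  bilDr succPr, bilNr succPr, bilDl succPl, bilNl succPl,
  fun a => bilDr (fun c u v p => combP2 p a c u v),
  fun a => bilNr (fun c u v p => combP2 p a c u v),
  fun a => bilDl (fun c u v q => combP1 q a c u v),
  fun a => bilNl (fun c u v q => combP1 q a c u v)).

(** Associativity of [tmul] is built up from the right: here both right factors are in [A], in
    [rho_mul] only the last one, in [tmulA] none. The associativity of [A] enters at this point
    only. In the graft and comb cases all double grafts cancel, and the induction hypothesis settles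
    the rest. *)
Lemma rho_rho v a b : rho (rho v a) b = rho v (a ⋅ b).
Proof.
(* The elements of [A] stay quantified: for v = q ≻ d the hypothesis on q is used at the pair d,
   a. *)
move: v a b; suff E v : forall a b, rho (rho v a) b = rho v (a ⋅ b) by [].
move: v; apply: model_ind =>
  [a b|c u v IHu IHv a b|d a b|q d IHq a b|p q d _ IHq a b].
- by rewrite !(bil0l rhoPl).
- by rewrite !rhoPl IHu IHv.
- by rewrite !rho_leaf amulA.
- rewrite !opE !distrE !opE !distrE IHq amulA; coefs.
- rewrite !opE !distrE !opE !distrE IHq amulA; coefs.
Qed.

Lemma rho_mul u v a : rho (tmul u v) a = tmul u (rho v a).
Proof.
move: v a; suff E v : forall a, rho (tmul u v) a = tmul u (rho v a) by [].
move: v; apply: model_ind => [a|c v w IHv IHw a|b a|q b IHq a|p q b IHp IHq a].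
- by rewrite (bil0l rhoPl) (bil0r tmulPr) (bil0l rhoPl).
- by rewrite tmulPr !rhoPl tmulPr IHv IHw.
- by rewrite rho_leaf !mul_leaf rho_rho.
- by rewrite !opE !distrE !opE.
- by rewrite !opE !distrE !opE.
Qed.

Lemma tmulA u v w : tmul u (tmul v w) = tmul (tmul u v) w.
Proof.
move: w; apply: model_eq => [||a|q a _|p q a IHp _]; [lin|lin|..].
- by rewrite !mul_leaf rho_mul.
- by rewrite !opE.
- by rewrite !opE IHp.
Qed.

(** For a comb p ∗ (q ≻ a), applying [succ_comb] twice produces the graft of u ∗ ((v ≻ p) ∗ q) with
    both signs; what remains is the formula for u ∗ v. *)
Lemma succ_succ u v w : tsucc u (tsucc v w) = tsucc (tmul u v) w.
Proof.
move: w; apply: model_eq => [||a|q a _|p q a IHp _]; [lin|lin|..].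
- by rewrite !opE.
- by rewrite !opE tmulA.
- by rewrite !opE !distrE !opE IHp !tmulA; coefs.
Qed.

Lemma mul_succ u v w :
  tmul (tsucc u v) w
  = tsucc (tsucc u v) w + tsucc u (tmul v w) - tsucc u (tsucc v w).
Proof.
rewrite succ_succ.
move: w; apply: model_eq => [||a|q a _|p q a IHp _]; [lin|lin|..].
- move: v; apply: model_eq => [||b|q b _|p q b _ _]; [lin|lin|..].
  + rewrite !opE; coefs.
  + rewrite !opE !distrE !opE rho_mul; coefs.
  + rewrite !opE !distrE !opE !rho_mul; coefs.
- rewrite !opE tmulA; coefs.
- rewrite !opE !tmulA IHp !distrE; coefs.
Qed.

Definition tprec u v := tmul u v - tsucc u v.

Lemma precPl c u v w : tprec (c *: u + v) w = c *: tprec u w + tprec v w.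
Proof. by rewrite /tprec tmulPl succPl; coefs. Qed.
Lemma precPr c u v w : tprec w (c *: u + v) = c *: tprec w u + tprec w v.
Proof. by rewrite /tprec tmulPr succPr; coefs. Qed.

Fact model_succ_succ u v w :
  tsucc u (tsucc v w) = tsucc (tsucc u v) w + tsucc (tprec u v) w.
Proof. by rewrite succ_succ /tprec (bilBl succPl) addrC subrK. Qed.
Fact model_succ_prec u v w : tsucc u (tprec v w) = tprec (tsucc u v) w.
Proof. by rewrite /tprec (bilBr succPr) mul_succ; coefs. Qed.
Fact model_prec_prec u v w :
  tprec u (tsucc v w) + tprec u (tprec v w) = tprec (tprec u v) w.
Proof.
rewrite /tprec (bilBr tmulPr) (bilBr succPr) (bilBl tmulPl) (bilBl succPl).
by rewrite mul_succ tmulA !succ_succ; coefs.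
Qed.

(* The argument is there for the products, which depend on A and on its basis. *)
Definition model (_ : lin_basis x) : Type := F.
HB.instance Definition _ := GRing.Lmodule.copy (model xb) F.
HB.instance Definition _ := @Lmodule_isPreAs.Build k (model xb) tsucc tprec
  succPl succPr precPl precPr model_succ_succ model_succ_prec model_prec_prec.

Lemma model_star (u v : model xb) : u ∗ v = tmul u v.
Proof. exact: subrKC. Qed.

(** This lets the basis [δ] be transported along an isomorphism from the model to any other
    envelope. *)
Lemma model_tree_val t :
  tree_val (fun i => leaf (x i) : model xb) t = δ t.
Proof.
elim: t => [i|q IHq i|p IHp q IHq i] /=.
- by rewrite leafE.
- by rewrite IHq -graftE -succ_leaf.
- by rewrite IHp IHq model_star -combE -mul_graft -succ_leaf.
Qed.

Definition model_leaf : A -> model xb := leaf.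

(** * Extending a homomorphism from the associative algebra to the trees *)

Section Evaluation.
Variables (P : preAsType k) (f : A -> P).
Hypothesis fh : assoc_hom (f : A -> plus_alg P).

Definition model_eval : F -> P := ext (tree_val (fun i => f (x i))).
Let g := model_eval.

Let fl : linear f. Proof. exact: fh.1. Qed.
Let fM a b : f (a ⋅ b) = f a ∗ f b. Proof. exact: fh.2. Qed.

Lemma eval_linear : linear g. Proof. exact: lin_ext_linear. Qed.

Let gE := (eval_linear, linE, fl, @presuccPl k P, @presuccPr k P,
  @prestarPl k P, @prestarPr k P).

Lemma eval_leaf a : g (leaf a) = f a.
Proof.
move: a; apply: leaf_ext => [c a b|c a b|i]; rewrite ?gE //.
by rewrite leafE [LHS]lin_extE.
Qed.

Lemma eval_graft q a : g (graft q a) = g q ≻ f a.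
Proof.
move: q a; apply: graft_ext =>
  [c u v a|c a b u|c u v a|c a b u|t i]; rewrite ?gE //.
by rewrite graftE /g /model_eval !lin_extE.
Qed.

Lemma eval_comb p q a : g (comb p q a) = g p ∗ (g q ≻ f a).
Proof.
move: p q a; apply: comb_ext =>
  [c u v q a|c u v p a|c a b p q|c u v q a|c u v p a|c a b p q|s t i];
  rewrite ?gE //.
by rewrite combE /g /model_eval !lin_extE.
Qed.

Let gopE := (eval_leaf, eval_graft, eval_comb).
Let gD u v : g (u + v) = g u + g v.
Proof. by have := eval_linear 1 u v; rewrite !scale1r. Qed.
Let gB u v : g (u - v) = g u - g v.
Proof. by rewrite addrC -scaleN1r eval_linear scaleN1r addrC. Qed.

(** The recursion defining [rho] is an instance of [star_succl], which holds in [P]; at a leaf it is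
    the multiplicativity of [f]. The next two lemmas work in the same way. *)
Lemma eval_rho v a : g (rho v a) = g v ∗ f a.
Proof.
move: v a; suff E v : forall a, g (rho v a) = g v ∗ f a by [].
move: v; apply: model_ind => [a|c u v IHu IHv a|b a|q b IHq a|p q b IHp IHq a].
- by rewrite (bil0l rhoPl) (lin_fun0 eval_linear) (bil0l (@prestarPl k P)).
- by rewrite rhoPl !eval_linear prestarPl IHu IHv.
- by rewrite rho_leaf !gopE fM.
- by rewrite rho_graft gB gD !gopE fM IHq star_succl.
- rewrite rho_comb gB gD !gopE fM IHq -prestarA star_succl.
  by rewrite (bilBr (@prestarPr k P)) (bilDr (@prestarPr k P)).
Qed.

Lemma eval_mul v u : g (tmul v u) = g v ∗ g u.
Proof.
move: u; apply: model_eq => [c u w|c u w|a|q a _|p q a IHp _].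
- by rewrite tmulPr eval_linear.
- by rewrite eval_linear prestarPr.
- by rewrite mul_leaf eval_rho gopE.
- by rewrite mul_graft !gopE.
- by rewrite mul_comb !gopE IHp prestarA.
Qed.

Lemma eval_succ v u : g (tsucc v u) = g v ≻ g u.
Proof.
move: u; apply: model_eq => [c u w|c u w|a|q a _|p q a IHp _].
- by rewrite succPr eval_linear.
- by rewrite eval_linear presuccPr.
- by rewrite succ_leaf !gopE.
- by rewrite succ_graft !gopE eval_mul succ_starl.
- rewrite succ_comb gD gB !gopE !eval_mul IHp.
  rewrite (star_succl _ _ (_ ≻ _)) !succ_starl.
  by rewrite [LHS]addrAC subrK addrAC subrr add0r.
Qed.
End Evaluation.

Lemma model_universal : universal_envelope model_leaf.
Proof.
have hom : assoc_hom (model_leaf : A -> plus_alg (model xb)).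
  split=> [|a b]; first exact: leafP.
  by rewrite -[RHS]/(_ ∗ _) model_star [RHS]mul_leaf rho_leaf.
split=> // [S [S0 SP Ss Sp] Sl|P f fh].
  have SD u v : S u -> S v -> S (u + v) by rewrite -{2}[u]scale1r; apply: SP.
  have Sg q a : S q -> S (graft q a).
    by move=> Sq; rewrite -succ_leaf; apply: Ss.
  apply: model_ind => // p q a Sp1 Sq.
  rewrite -mul_graft -model_star; apply: SD.
    by apply: Ss => //; apply: Sg.
  by apply: Sp => //; apply: Sg.
exists (model_eval f); last exact: eval_leaf.
split=> [|u v|u v]; first exact: eval_linear.
  exact: eval_succ.
(* Compatibility with ≺ follows from that with ≻ and ∗, after adding the ≻-product to both sides. *)
apply: (addrI (model_eval f u ≻ model_eval f v)).
rewrite -[RHS]/(_ ∗ _) -(eval_mul fh) -[tmul u v]model_star.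
by rewrite -(eval_succ fh) -[X in X + _ = _]scale1r -eval_linear scale1r.
Qed.
End Model.

(** * Envelopes and normal forms *)

Section Homs.
Variables (k : fieldType) (P Q : preAsType k).

Lemma pre_hom_star (g : P -> Q) u v : pre_hom g -> g (u ∗ v) = g u ∗ g v.
Proof.
move=> [gl gs gp]; rewrite /prestar -gs -gp.
by have := gl 1 (u ≻ v) (u ≺ v); rewrite !scale1r.
Qed.

Lemma pre_hom_tree_val (g : P -> Q) X (y : X -> P) t :
  pre_hom g -> g (tree_val y t) = tree_val (fun i => g (y i)) t.
Proof.
move=> gh; elim: t => [//|q IHq i|p IHp q IHq i] /=.
  by case: gh => _ -> _; rewrite IHq.
by rewrite pre_hom_star // IHp; case: gh => _ -> _; rewrite IHq.
Qed.

Lemma pre_hom_eq (T : Type) (y : T -> P) (g h : P -> Q) :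
  pre_generated y -> pre_hom g -> pre_hom h ->
  (forall t, g (y t) = h (y t)) -> g =1 h.
Proof.
move=> gen [gl gs gp] [hl hs hp] E; apply: gen => //; split.
- by rewrite (lin_fun0 gl) (lin_fun0 hl).
- by move=> a u v gu gv; rewrite gl hl gu gv.
- by move=> u v gu gv; rewrite gs hs gu gv.
- by move=> u v gu gv; rewrite gp hp gu gv.
Qed.
End Homs.

(** The usual uniqueness argument: [universal_envelope] asks only that extensions exist, and their
    uniqueness comes from generation through [pre_hom_eq]. *)
Lemma envelope_iso (k : fieldType) (A : assocType k) (U U' : preAsType k)
    (iota : A -> U) (iota' : A -> U') :
  universal_envelope iota -> universal_envelope iota' ->
  exists f : U -> U', exists2 g : U' -> U,
    [/\ pre_hom f, pre_hom g, cancel f g & cancel g f] &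
    (forall a, f (iota a) = iota' a) /\ (forall a, g (iota' a) = iota a).
Proof.
move=> [ih igen iU] [ih' igen' iU'].
have [f fh fi] := iU _ _ ih'; have [g gh gi] := iU' _ _ ih.
have comp (P Q R : preAsType k) (u : P -> Q) (v : Q -> R) :
    pre_hom u -> pre_hom v -> pre_hom (v \o u).
  move=> [ul us up] [vl vs vp]; split=> [a y z|y z|y z] /=.
  - by rewrite ul vl.
  - by rewrite us vs.
  - by rewrite up vp.
exists f; exists g => //; split=> //.
- apply: (pre_hom_eq igen (comp _ _ _ _ _ fh gh)) => [|a] /=; first by split.
  by rewrite fi.
- apply: (pre_hom_eq igen' (comp _ _ _ _ _ gh fh)) => [|a] /=; first by split.
  by rewrite gi.
Qed.

Lemma tree_basis (k : fieldType) (A : assocType k) (X : choiceType) (x : X -> A)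
    (U : preAsType k) (iota : A -> U) :
  lin_basis x -> universal_envelope iota ->
  lin_basis (tree_val (fun i => iota (x i))).
Proof.
move=> xb Uu; have [f [g [fh gh fK gK] [fi gi]]] :=
  envelope_iso (model_universal xb) Uu.
have [fl _ _] := fh.
have := lin_basis_bij (@delta_basis k (tree X)) fl (Bijective fK gK) (h := id).
move=> /(_ (Bijective (frefl _) (frefl _))).
congr lin_basis; apply/funext => t.
rewrite -(model_tree_val xb) (pre_hom_tree_val _ _ fh).
by congr (tree_val _ t); apply/funext => i; rewrite -fi.
Qed.

(** * Normal forms as trees *)

Section NormalForms.
Variable X : Type.

(** A pair (u, s) is a normal form stripped of its validity proof. The word u(s_1(s_2(...(s_m i))))
    has the value (u ∗ s_1 ∗ ... ∗ s_m) ≻ i, so every word of length > 1 encodes a pair and a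
    letter. *)
Definition spine (p : word X * seq (word X)) (i : X) : word X :=
  Mul p.1 (foldr (@Mul X) (Letter i) p.2).

Fixpoint nf_words (t : tree X) : word X * seq (word X) :=
  match t with
  | Leaf i => (Letter i, [::])
  | Graft q i => (spine (nf_words q) i, [::])
  | Comb p q i => ((nf_words p).1, rcons (nf_words p).2 (spine (nf_words q) i))
  end.

Definition is_nf (p : word X * seq (word X)) : bool :=
  [&& reduced p.1, all (@reduced X) p.2 & all (fun u => 1 < wlen u)%N p.2].

Lemma wlen_gt0 (u : word X) : (0 < wlen u)%N.
Proof. by elim: u => //= u IHu v IHv; rewrite addn_gt0 IHu. Qed.

Lemma reducedM (u v : word X) :
  reduced (Mul u v) = [&& ~~ forbidden (Mul u v), reduced u & reduced v].
Proof. by rewrite /reduced /= has_cat !negb_or. Qed.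

Lemma right_spine (v : word X) : exists s i, v = foldr (@Mul X) (Letter i) s.
Proof.
elim: v => [i|u _ v [s [i ->]]]; first by exists [::], i.
by exists (u :: s), i.
Qed.

Lemma foldr_Mul_inj (s s' : seq (word X)) i i' :
  foldr (@Mul X) (Letter i) s = foldr (@Mul X) (Letter i') s' -> s = s' /\ i = i'.
Proof.
elim: s s' => [|u s IH] [|u' s'] //=; first by case=> ->.
by case=> -> /IH[-> ->].
Qed.

Lemma spine_inj p p' i i' : spine p i = spine p' i' -> p = p' /\ i = i'.
Proof.
by case: p p' => [u s] [u' s'] [/= -> /foldr_Mul_inj[-> ->]].
Qed.

Lemma forbiddenM (u v w : word X) :
  forbidden (Mul u (Mul v w)) = ~~ (1 < wlen v)%N.
Proof.
case: v => //= v v'; apply/esym/negbF.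
by rewrite -[2%N]/(1 + 1)%N leq_add ?wlen_gt0.
Qed.

(** A forbidden subword starting on the right spine occurs exactly when a factor after the first is
    a letter. Its exclusion is thus the length condition on the tail of a normal form; the final
    letter is harmless because nothing follows it. *)
Lemma reduced_spine p i : reduced (spine p i) = is_nf p.
Proof.
(* The left factor u is arbitrary, as [forbidden] inspects only the right factor. *)
have E s u : ~~ forbidden (Mul u (foldr (@Mul X) (Letter i) s))
      && reduced (foldr (@Mul X) (Letter i) s)
    = all (@reduced X) s && all (fun v => 1 < wlen v)%N s.
  elim: s u => // v s IH u.
  rewrite -[foldr _ _ _]/(Mul v (foldr (@Mul X) (Letter i) s)).
  rewrite forbiddenM negbK reducedM [X in _ && X]andbCA IH /=.
  by case: (1 < _)%N; rewrite /= ?andbF ?andbA.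
by rewrite /spine reducedM andbCA E.
Qed.

Lemma wlen_foldr (s : seq (word X)) i :
  wlen (foldr (@Mul X) (Letter i) s) = (sumn [seq wlen u | u <- s]).+1.
Proof. by elim: s => //= u s ->; rewrite addnS. Qed.

Lemma wlen_spine p i :
  wlen (spine p i) = (wlen p.1 + (sumn [seq wlen u | u <- p.2]).+1)%N.
Proof. by rewrite /= wlen_foldr. Qed.

Lemma nf_words_nf t : is_nf (nf_words t).
Proof.
elim: t => [//|q IHq i|p IHp q IHq i].
  by rewrite /is_nf /= reduced_spine IHq.
rewrite /is_nf [nf_words _]/= !all_rcons reduced_spine IHq wlen_spine.
by rewrite -[2%N]/(1 + 1)%N leq_add ?wlen_gt0.
Qed.

Lemma nf_words_inj : injective nf_words.
Proof.
elim=> [i|q IHq i|p IHp q IHq i] [j|q' j|p' q' j] //.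
- by case=> ->.
- by move/(congr1 (size \o snd)); rewrite /= size_rcons.
- case=> E1 E2.
  suff /spine_inj[/IHq -> ->] : spine (nf_words q) i = spine (nf_words q') j by [].
  by rewrite /spine E1 E2.
- by move/(congr1 (size \o snd)); rewrite /= size_rcons.
- by move/(congr1 (size \o snd)); rewrite /= size_rcons.
- by move/(congr1 (size \o snd)); rewrite /= size_rcons.
- case=> E1 /rcons_inj[E2 E3 E4].
  have /spine_inj[/IHq -> ->] : spine (nf_words q) i = spine (nf_words q') j.
    by rewrite /spine E3 E4.
  by rewrite (IHp p') // [LHS]surjective_pairing E1 E2 -surjective_pairing.
Qed.

(** Strong induction on the total length. The last factor, or the head when the tail is empty, is a
    letter only in the leaf case; otherwise it is a spine, and dropping its final letter leaves
    shorter normal forms. *)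
Lemma nf_words_surj p : is_nf p -> exists t, nf_words t = p.
Proof.
have [n] := ubnP (wlen p.1 + sumn [seq wlen u | u <- p.2]).
elim: n p => // n IH [u s] /=; case: (lastP s) => [|s' v].
  case: u => [i|u v]; first by exists (Leaf i).
  have [r [i ->]] := right_spine v.
  rewrite [wlen _]/= wlen_foldr addn0 addnS ltnS => lt_n.
  rewrite /is_nf /= !andbT -[Mul _ _]/(spine (u, r) i) reduced_spine.
  by move=> /(IH (u, r) lt_n)[t Et]; exists (Graft t i); rewrite /= Et.
case: v => [i|v w]; first by rewrite /is_nf /= !all_rcons /= !andbF.
have [r [i ->]] := right_spine w.
rewrite map_rcons sumn_rcons [wlen (Mul v _)]/= wlen_foldr ltnS => lt_n.
rewrite /is_nf /= !all_rcons => /and3P[nu /andP[nv ns] /andP[_ ls]].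
have [|p Ep] := IH (u, s') _ (introT and3P (And3 nu ns ls)).
  by move: lt_n => /=; lia.
have [||q Eq] := IH (v, r).
- by move: lt_n (wlen_gt0 u) => /=; lia.
- by rewrite -(reduced_spine _ i).
by exists (Comb p q i); rewrite /= Ep Eq.
Qed.

Definition nf_of_tree (t : tree X) : normal_form X :=
  NormalForm (nf_words_nf t).

Lemma nf_of_tree_bij : bijective nf_of_tree.
Proof.
have surj w : {t | nf_of_tree t = w}.
  apply: cid; case: w => u s us; have [t Et] := nf_words_surj (p := (u, s)) us.
  exists t; rewrite /nf_of_tree; move: (nf_words_nf t); rewrite Et => us'.
  by rewrite (bool_irrelevance us us').
exists (fun w => sval (surj w)) => [t|w]; last exact: svalP (surj w).
apply: nf_words_inj; have := svalP (surj (nf_of_tree t)).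
case=> E1 E2.
by rewrite [LHS]surjective_pairing E1 E2 -surjective_pairing.
Qed.

Lemma nf_val_tree (k : fieldType) (P : preAsType k) (y : X -> P) t :
  nf_val y (nf_of_tree t) = tree_val y t.
Proof.
rewrite /nf_val /=.
pose val p := foldl (@prestar k P) (word_val y p.1) [seq word_val y u | u <- p.2].
(* The right spine is folded from the left by repeated use of [succ_starl], with the value z of the
   head generalized. *)
have val_spine p i : word_val y (spine p i) = val p ≻ y i.
  case: p => u s; rewrite /val /=; elim: s (word_val y u) => //= v s IH z.
  by rewrite -IH succ_starl.
rewrite -[LHS]/(val (nf_words t)); elim: t => [//|q IHq i|p IHp q IHq i].
  by rewrite /val val_spine IHq.
rewrite /val /= map_rcons foldl_rcons val_spine IHq.
by rewrite -[foldl _ _ _]/(val (nf_words p)) IHp.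
Qed.
End NormalForms.

Lemma nf_basis (k : fieldType) (A : assocType k) (X : choiceType) (x : X -> A)
    (U : preAsType k) (iota : A -> U) :
  lin_basis x -> universal_envelope iota ->
  lin_basis (nf_val (fun i => iota (x i))).
Proof.
move=> xb Uu; have [h hK Kh] := nf_of_tree_bij X.
have := lin_basis_bij (tree_basis xb Uu) (f := id) (h := h).
move=> /(_ _ (Bijective (frefl _) (frefl _)) (Bijective Kh hK)) b.
suff -> : nf_val (fun i => iota (x i)) =
    fun w => tree_val (fun i => iota (x i)) (h w).
  by apply: b => a u v.
by apply/funext => w; rewrite -nf_val_tree Kh.
Qed.

(** * The natural filtration and its associated graded algebra *)

Lemma tdeg_gt0 X (t : tree X) : (0 < tdeg t)%N.
Proof. by elim: t => //= p IHp q _ _; rewrite addn_gt0 IHp. Qed.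

(** * Degrees in the model *)

Section Degree.
Variables (k : fieldType) (A : assocType k) (X : choiceType) (x : X -> A).
Hypothesis xb : lin_basis x.

Local Notation F := (fmod k (tree X)).
Local Notation δ := (@delta k (tree X)).

Definition deg_le n (v : F) := forall t, fcoef v t != 0 -> (tdeg t <= n)%N.

Lemma deg_le0 n : deg_le n 0. Proof. by move=> t; rewrite eqxx. Qed.

Lemma deg_leP n (c : k) u v : deg_le n u -> deg_le n v -> deg_le n (c *: u + v).
Proof.
move=> un vn t; rewrite fcoefP => nz.
have [ut|/un//] := eqVneq (fcoef u t) 0.
by apply: vn; move: nz; rewrite ut mulr0 add0r.
Qed.

Lemma deg_leB n u v : deg_le n u -> deg_le n v -> deg_le n (u - v).
Proof. by move=> un vn; rewrite addrC -scaleN1r; apply: deg_leP. Qed.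
Lemma deg_leD n u v : deg_le n u -> deg_le n v -> deg_le n (u + v).
Proof. by move=> un vn; rewrite -[u]scale1r; apply: deg_leP. Qed.

Lemma deg_le_mono m n v : (m <= n)%N -> deg_le m v -> deg_le n v.
Proof. by move=> mn vm t /vm /leq_trans; apply. Qed.

Lemma deg_le_delta n t : (tdeg t <= n)%N -> deg_le n (δ t).
Proof.
move=> tn t'; rewrite fcoef_delta.
by have [->|] := eqVneq t' t; rewrite ?eqxx.
Qed.

Lemma deg_le_ind n (S : F -> Prop) :
  S 0 -> (forall (c : k) u v, S u -> S v -> S (c *: u + v)) ->
  (forall t, (tdeg t <= n)%N -> S (δ t)) -> forall v, deg_le n v -> S v.
Proof.
move=> S0 SP Sd v vn; have [s _ ->] := fmod_sum v.
elim/big_rec: _ => // t u _ Su; have [->|/vn tn] := eqVneq (fcoef v t) 0.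
  by rewrite scale0r add0r.
by apply: SP => //; apply: Sd.
Qed.

Lemma deg_le_linear m n (f : F -> F) : linear f ->
  (forall t, (tdeg t <= m)%N -> deg_le n (f (δ t))) ->
  forall v, deg_le m v -> deg_le n (f v).
Proof.
move=> fl fd; apply: deg_le_ind => // [|c u v].
  by rewrite (lin_fun0 fl); apply: deg_le0.
by rewrite fl; apply: deg_leP.
Qed.

Lemma deg_le_basis n (f : A -> F) : linear f ->
  (forall i, deg_le n (f (x i))) -> forall a, deg_le n (f a).
Proof.
move=> fl fd; apply: (basis_ind xb) => // [|c u v].
  by rewrite (lin_fun0 fl); apply: deg_le0.
by rewrite fl; apply: deg_leP.
Qed.

Lemma deg_le_leaf a : deg_le 1 (leaf xb a).
Proof.
move: a; apply: deg_le_basis => [|i]; first exact: leafP.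
by rewrite leafE; apply: deg_le_delta.
Qed.

Lemma deg_le_graft n q a : deg_le n q -> deg_le n.+1 (graft xb q a).
Proof.
move: q; apply: deg_le_linear => [c u v|t tn]; first exact: graftPl.
move: a; apply: deg_le_basis => [c u v|i]; first exact: graftPr.
by rewrite graftE; apply: deg_le_delta.
Qed.

Lemma deg_le_comb m n p q a :
  deg_le m p -> deg_le n q -> deg_le (m + n).+1 (comb xb p q a).
Proof.
move=> pm; move: q; apply: deg_le_linear => [c u v|t tn]; first exact: combP2.
move: p pm; apply: deg_le_linear => [c u v|s sm]; first exact: combP1.
move: a; apply: deg_le_basis => [c u v|i]; first exact: combP3.
by rewrite combE; apply: deg_le_delta; rewrite /= addnS ltnS leq_add.
Qed.

(** The terms containing the product of [A] merge two letters into one and so fall below the top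
    degree; this is why that product becomes invisible in the associated graded algebra. *)
Lemma deg_le_rho n v a : deg_le n v -> deg_le n.+1 (rho xb v a).
Proof.
move: v; apply: deg_le_linear => [c u v|t tn]; first exact: rhoPl.
apply: (@deg_le_mono (tdeg t).+1) => //.
elim: t {tn} a => [i|q IHq i|p _ q IHq i] a /=.
- rewrite -(leafE xb) rho_leaf; apply: (@deg_le_mono 1) => //; exact: deg_le_leaf.
- have dq : deg_le (tdeg q) (δ q) by apply: deg_le_delta.
  rewrite -(graftE xb) rho_graft.
  apply: deg_leB; last exact: deg_le_graft (IHq _).
  apply: deg_leD; first by do 2 apply: deg_le_graft.
  by apply: (deg_le_mono (leqnSn _)); apply: deg_le_graft.
- have dp : deg_le (tdeg p) (δ p) by apply: deg_le_delta.
  have dq : deg_le (tdeg q) (δ q) by apply: deg_le_delta.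
  rewrite -(combE xb) rho_comb.
  apply: deg_leB; last exact: deg_le_comb dp (IHq _).
  apply: deg_leD; first by apply: deg_le_comb => //; apply: deg_le_graft.
  by rewrite addnS; apply: (deg_le_mono (leqnSn _)); apply: deg_le_comb.
Qed.

Lemma deg_le_mul m n u v :
  deg_le m u -> deg_le n v -> deg_le (m + n) (tmul xb u v).
Proof.
move=> um; move: v; apply: deg_le_linear => [c v w|t tn]; first exact: tmulPr.
apply: (@deg_le_mono (m + tdeg t)); first by rewrite leq_add2l.
elim: t {tn} => [i|q _ i|p IHp q _ i] /=.
- by rewrite -(leafE xb) mul_leaf addn1; apply: deg_le_rho.
- by rewrite -(graftE xb) mul_graft addnS; apply: deg_le_comb => //;
  apply: deg_le_delta.
- rewrite -(combE xb) mul_comb addnA addnS.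
  by apply: deg_le_comb => //; apply: deg_le_delta.
Qed.

Lemma deg_le_succ m n u v :
  deg_le m u -> deg_le n v -> deg_le (m + n) (tsucc xb u v).
Proof.
move=> um; move: v; apply: deg_le_linear => [c v w|t tn]; first exact: succPr.
apply: (@deg_le_mono (m + tdeg t)); first by rewrite leq_add2l.
elim: t {tn} => [i|q _ i|p IHp q _ i] /=.
- by rewrite -(leafE xb) succ_leaf addn1; apply: deg_le_graft.
- rewrite -(graftE xb) succ_graft addnS; apply/deg_le_graft/deg_le_mul => //.
  exact: deg_le_delta.
- have dp : deg_le (tdeg p) (δ p) by apply: deg_le_delta.
  have dq : deg_le (tdeg q) (δ q) by apply: deg_le_delta.
  rewrite -(combE xb) succ_comb addnS addnS; apply: deg_leD.
    apply: deg_leB; rewrite addnA; first exact: deg_le_comb.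
    by apply/deg_le_graft/deg_le_mul.
  by apply/deg_le_graft/deg_le_mul => //; apply: deg_le_mul.
Qed.

Lemma deg_le_prec m n u v :
  deg_le m u -> deg_le n v -> deg_le (m + n) (tprec xb u v).
Proof.
by move=> um vn; apply: deg_leB; [apply: deg_le_mul|apply: deg_le_succ].
Qed.
End Degree.

Section NaturalFiltration.
Variables (k : fieldType) (A : assocType k) (X : choiceType) (x : X -> A).
Hypothesis xb : lin_basis x.
Variables (U : preAsType k) (iota : A -> U).
Variables (f : U -> model xb) (g : model xb -> U).
Hypotheses (fh : pre_hom f) (gh : pre_hom g).
Hypotheses (fK : cancel f g) (gK : cancel g f).
Hypotheses (fi : forall a, f (iota a) = leaf xb a).
Hypotheses (gi : forall a, g (leaf xb a) = iota a).
Local Notation δ := (@delta k (tree X)).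
Local Notation natF := (natural_filtration iota).

Lemma iota_fil a : natF 1 (iota a).
Proof.
rewrite -[iota a]scale1r -[1 *: _]addr0; apply: spanP; last exact: span0.
by exists 1%N => //; apply: product_gen.
Qed.

Lemma tree_val_fil (t : tree X) :
  natF (tdeg t) (tree_val (fun i => iota (x i)) t).
Proof.
elim: t => [i|q IHq i|p IHp q IHq i] /=; first exact: iota_fil.
  rewrite -addn1; apply: (fil_succ (f := natF)) => //; exact: iota_fil.
have qi : natF (tdeg q).+1 (tree_val (fun i => iota (x i)) q ≻ iota (x i)).
  by rewrite -addn1; apply: fil_succ => //; apply: iota_fil.
rewrite /prestar -[X in X + _]scale1r; apply: (filP (f := natF)).
  exact: (fil_succ (f := natF)).
exact: (fil_prec (f := natF)).
Qed.

Lemma tree_val_delta t : tree_val (fun i => iota (x i)) t = g (δ t).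
Proof.
rewrite -(model_tree_val xb) (pre_hom_tree_val _ _ gh).
by congr (tree_val _ t); apply/funext => i.
Qed.

(** A tree of degree d is a sum of products of d elements of the image of [A]; conversely the degree
    is subadditive for both products. *)
Lemma natural_fil_deg n u : natF n u <-> deg_le n (f u).
Proof.
have [[fl fs fp] [gl _ _]] := (fh, gh); split; last first.
  rewrite -{2}[u]fK; move: (f u); apply: deg_le_ind => [|c v w vn wn|t tn].
  - by rewrite (lin_fun0 gl); apply: fil0.
  - by rewrite gl; apply: filP.
  - by rewrite -tree_val_delta; apply: fil_mono tn (tree_val_fil t).
elim=> [|c v w [m mn vm] _ IH]; first by rewrite (lin_fun0 fl); apply: deg_le0.
rewrite fl; apply: deg_leP => //; apply: deg_le_mono mn _.
elim: vm => [a|{}m n' y z _ IHy _ IHz|{}m n' y z _ IHy _ IHz].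
- by rewrite fi; apply: deg_le_leaf.
- by rewrite fs; apply: deg_le_succ.
- by rewrite fp; apply: deg_le_prec.
Qed.
End NaturalFiltration.

(** * Homogeneous elements of the associated graded algebra *)

Section GradedElements.
Variables (k : fieldType) (P : preAsType k) (F : filtration P).

Definition single (n : nat) (u : P) : nat -> P :=
  fun m => if m == n then u else 0.

Fact single_rees n u : F n u -> single n u \in rees_pred F.
Proof.
move=> Fu; apply/asboolP; split=> [m|].
  by rewrite /single; case: eqP => [->|_] //; apply: fil0.
by exists n.+1 => m; rewrite /single; case: eqP => // ->; rewrite ltnn.
Qed.

Definition gr_class n u (Fu : F n u) : gr F := gr_pi (Rees (single_rees Fu)).

(** The membership proofs have types that mention the degree and the vector, so plain rewriting is
    awkward; only these two data matter for the class. *)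
Lemma gr_class_eq m n u v (Fu : F m u) (Fv : F n v) : m = n -> u = v ->
  gr_class Fu = gr_class Fv.
Proof. by move=> mn uv; congr gr_pi; apply: val_inj; rewrite /= mn uv. Qed.

Lemma conv_single (op : P -> P -> P) m n u v :
  (forall z, op 0 z = 0) -> (forall z, op z 0 = 0) ->
  conv_fun op (single m u) (single n v) = single (m + n) (op u v).
Proof.
move=> op0l op0r; apply/funext => l; rewrite /conv_fun /single.
have [->|lmn] := eqVneq l (m + n)%N.
  have lm : (m < (m + n).+1)%N by rewrite ltnS leq_addr.
  rewrite (bigD1 (Ordinal lm)) //= eqxx addKn eqxx big1 ?addr0 // => i im.
  by rewrite ifN ?op0l // (contra _ im) // => /eqP E; apply/eqP/val_inj.
rewrite big1 // => i _; case: eqP => [im|]; last by rewrite op0l.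
case: eqP => [lin|]; last by rewrite op0r.
by case/eqP: lmn; rewrite -im -lin subnKC // -ltnS.
Qed.

Lemma gr_class_lin n (c : k) u v (Fu : F n u) (Fv : F n v) :
  gr_class (filP c Fu Fv) = c *: gr_class Fu + gr_class Fv.
Proof.
rewrite -gr_piZ -gr_piD; congr gr_pi; apply: val_inj; apply/funext => m /=.
rewrite -[RHS]/(c *: single n u m + single n v m) /single.
by case: eqP; rewrite ?scaler0 ?addr0.
Qed.

Lemma gr_class_succ m n u v (Fu : F m u) (Fv : F n v) :
  gr_class Fu ≻ gr_class Fv = gr_class (fil_succ Fu Fv).
Proof.
rewrite -[LHS]/(gr_succ _ _) gr_pi_succ; congr gr_pi; apply: val_inj => /=.
apply: conv_single => z; first exact: bil0l (@presuccPl k P) _.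
exact: bil0r (@presuccPr k P) _.
Qed.

Lemma gr_class_prec m n u v (Fu : F m u) (Fv : F n v) :
  gr_class Fu ≺ gr_class Fv = gr_class (fil_prec Fu Fv).
Proof.
rewrite -[LHS]/(gr_prec _ _) gr_pi_prec; congr gr_pi; apply: val_inj => /=.
apply: conv_single => z; first exact: bil0l (@preprecPl k P) _.
exact: bil0r (@preprecPr k P) _.
Qed.

Fact fil_star m n u v : F m u -> F n v -> F (m + n) (u ∗ v).
Proof.
move=> Fu Fv; rewrite /prestar -[u ≻ v]scale1r.
by apply: filP; [apply: fil_succ|apply: fil_prec].
Qed.

Lemma gr_class_star m n u v (Fu : F m u) (Fv : F n v) :
  gr_class Fu ∗ gr_class Fv = gr_class (fil_star Fu Fv).
Proof.
rewrite /prestar gr_class_succ gr_class_prec -[X in X + _]scale1r -gr_class_lin.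
by apply: gr_class_eq => //; rewrite scale1r.
Qed.

Lemma gr_class_low n u (Fu : F n.+1 u) : F n u -> gr_class Fu = 0.
Proof.
move=> Fnu; rewrite -[0](_ : gr_pi 0 = 0); last first.
  by have := gr_piZ 0 (0 : rees F); rewrite !scale0r.
apply/gr_piP; rewrite subr0; apply/asboolP; split=> [m /=|].
  by rewrite /single; case: eqP => [->//|_]; apply: fil_below0.
by have /asboolP[] := single_rees Fu.
Qed.
End GradedElements.

(** * The PBW-property *)

Section PBW.
Variables (k : fieldType) (A : assocType k).
Variables (U : preAsType k) (iota : A -> U).
Variables (U0 : preAsType k) (iota0 : zero_alg A -> U0).
Hypothesis Uu : universal_envelope iota.
Hypothesis U0u : universal_envelope iota0.
Local Notation natF := (natural_filtration iota).

(** The product of two classes of degree 1 sits in degree 2, but it is represented by the image of a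
    ⋅ b, which already lies in the first term of the filtration. So it vanishes, as the product of
    [zero_alg A] does. *)
Lemma gr_iota_hom :
  assoc_hom
    ((fun a => gr_class (iota_fil iota a)) : zero_alg A -> plus_alg (gr natF)).
Proof.
have [[il iM] _ _] := Uu; split=> [c a b|a b].
  by rewrite -gr_class_lin; apply: gr_class_eq => //; apply: il.
rewrite -[RHS]/(_ ∗ _) gr_class_star [RHS]gr_class_low; last first.
  by rewrite -[_ ∗ _]iM; apply: iota_fil.
rewrite -[LHS]/(gr_class (iota_fil iota 0)) gr_class_low //.
by rewrite (lin_fun0 il); apply: fil0.
Qed.

Section Coefficients.
Variables (X : choiceType) (x : X -> A).
Hypothesis xb : lin_basis x.
Variables (f : U -> model xb) (g : model xb -> U).
Hypotheses (fh : pre_hom f) (gh : pre_hom g).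
Hypotheses (fK : cancel f g) (gK : cancel g f).
Hypotheses (fi : forall a, f (iota a) = leaf xb a).
Hypotheses (gi : forall a, g (leaf xb a) = iota a).

Let fl : linear f. Proof. by case: fh. Qed.
Let natFE n u : natF n u <-> deg_le n (f u).
Proof. exact: natural_fil_deg fh gh fK fi gi n u. Qed.

(** The coordinate of y at t, read off the component whose degree is that of t. *)
Definition gr_coef (y : gr natF) (t : tree X) : k :=
  fcoef (f (gr_repr y (tdeg t))) t.

(** Two representatives differ in degree n by an element of degree < n, which has no coefficient at
    a tree of degree n. *)
Lemma gr_coef_pi u t : gr_coef (gr_pi u) t = fcoef (f (u (tdeg t))) t.
Proof.
have /asboolP[low _] := gr_repr_low u.
set v := gr_repr (gr_pi u) in low *.
have -> : gr_coef (gr_pi u) t = fcoef (f (v (tdeg t))) t by [].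
have -> : v (tdeg t) = 1 *: (v - u) (tdeg t) + u (tdeg t).
  by rewrite scale1r; apply/esym/subrK.
rewrite fl fcoefP mul1r; move: (low (tdeg t)); case E: (tdeg t) => [|n] /=.
  by have := tdeg_gt0 t; rewrite E.
move=> /natFE dn; have [->|/dn] := eqVneq (fcoef (f ((v - u) n.+1)) t) 0.
  by rewrite add0r.
by rewrite E ltnn.
Qed.

Lemma gr_coef_lin (c : k) y z t :
  gr_coef (c *: y + z) t = c * gr_coef y t + gr_coef z t.
Proof.
rewrite -[y]gr_reprK -[z]gr_reprK -gr_piZ -gr_piD !gr_coef_pi.
by rewrite -fcoefP -fl.
Qed.

Lemma gr_coef0 t : gr_coef 0 t = 0.
Proof.
by have := gr_coef_lin (-1) 0 0 t; rewrite scaler0 addr0 mulN1r addNr.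
Qed.

(** The n-th component of the difference of representatives has degree at most n and no coefficient
    at trees of degree n, so it lies one step lower in the filtration. *)
Lemma gr_coef_inj y z : gr_coef y =1 gr_coef z -> y = z.
Proof.
move=> yz; rewrite -[y]gr_reprK -[z]gr_reprK; apply/gr_piP.
set u := gr_repr y; set v := gr_repr z.
have [Fw finw] := reesP (u - v); apply/asboolP; split=> // n.
have w0 t : tdeg t = n -> fcoef (f ((u - v) n)) t = 0.
  move=> <-; have -> : (u - v) (tdeg t) = (-1) *: v (tdeg t) + u (tdeg t).
    by rewrite scaleN1r addrC.
  by rewrite fl fcoefP mulN1r [fcoef (f (u _)) t]yz addNr.
have /natFE dw := Fw n; case: n dw w0 => [|n] dw w0.
  (* In degree 0 the component must be 0 itself, which holds as no tree has degree 0. *)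
  rewrite /= -[LHS]fK -[RHS]fK; congr g; rewrite (lin_fun0 fl); apply: fmodP => t.
  apply/eqP; rewrite fcoef0; apply/negPn/negP => /dw.
  by rewrite leqNgt tdeg_gt0.
apply/natFE => t nz; rewrite -ltnS ltn_neqAle dw // andbT.
by apply: contra nz => /eqP tn; rewrite w0.
Qed.

Lemma gr_coef_class n u (Fu : natF n u) t :
  gr_coef (gr_class Fu) t = if tdeg t == n then fcoef (f u) t else 0.
Proof.
rewrite gr_coef_pi /= /single; case: eqP => // _.
by rewrite (lin_fun0 fl).
Qed.
End Coefficients.

Lemma gr_envelope_iso : pre_iso (gr natF) U0.
Proof.
have [X [x xb]] := basis_exists A.
(* Both algebras have the same underlying space, so one basis gives the same trees for both
   models. *)
have xb0 : lin_basis (x : X -> zero_alg A) := xb.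
have [f [g [fh gh fK gK] [fi gi]]] := envelope_iso Uu (model_universal xb).
have [f0 [g0 [f0h g0h f0K g0K] [f0i g0i]]] :=
  envelope_iso U0u (model_universal xb0).
have [_ _ ext0] := U0u; have [G Gh Gi] := ext0 _ _ gr_iota_hom.
have [fl _ _] := fh; have [Gl _ _] := Gh; have [g0l _ _] := g0h.
have G_tree t : G (tree_val (fun i => iota0 (x i)) t) =
    gr_class (tree_val_fil x iota t).
  rewrite (pre_hom_tree_val _ _ Gh); elim: t => [i|q IHq i|p IHp q IHq i] /=.
  - by rewrite Gi; apply: gr_class_eq.
  - by rewrite IHq Gi gr_class_succ; apply: gr_class_eq; rewrite ?addn1.
  - rewrite IHp IHq Gi gr_class_succ gr_class_star.
    by apply: gr_class_eq; rewrite ?addn1.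
(* In tree coordinates [G] is the identity, which yields its injectivity and, with [gr_coef_inj],
   its surjectivity. *)
have GE u t : gr_coef f (G u) t = fcoef (f0 u) t.
  rewrite -{1}[u]f0K; move: (f0 u) => {u}.
  apply: (basis_ind (@delta_basis k (tree X))) => [|c u v Eu Ev|s].
  - by rewrite (lin_fun0 g0l) (lin_fun0 Gl) (gr_coef0 fh gh fK fi gi).
  - by rewrite g0l Gl (gr_coef_lin fh gh fK fi gi) Eu Ev fcoefP.
  rewrite -(tree_val_delta g0h g0i) G_tree (gr_coef_class fh gh fK fi gi).
  rewrite (tree_val_delta gh gi) gK fcoef_delta.
  by case: eqP => // ts; case: eqP ts => // ->.
have Ginj : injective G.
  move=> u v Guv; apply: (can_inj f0K); apply: fmodP => t.
  by rewrite -!GE Guv.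
have Gsurj y : exists u, G u = y.
  have supp n : {s : seq (tree X) |
      forall t, t \notin s -> fcoef (f (gr_repr y n)) t = 0}.
    by apply: cid; have /asboolP := valP (f (gr_repr y n)).
  (* Only finitely many components of y are nonzero and each has finite support, so the coordinates
     of y define an element of the model of [U0]. *)
  have fin : (fun t => gr_coef f y t : k^o) \in @finsupp_pred k (tree X).
    have [_ [N yN]] := reesP (gr_repr y); apply/asboolP.
    exists (flatten [seq sval (supp n) | n <- index_iota 0 N]) => t tN.
    have [lt_tN|le_Nt] := ltnP (tdeg t) N; last first.
      by rewrite /gr_coef yN // (lin_fun0 fl).
    apply: (svalP (supp (tdeg t))); apply: contra tN => ts.
    apply/flattenP; exists (sval (supp (tdeg t))) => //.
    by apply: map_f; rewrite mem_index_iota.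
  exists (g0 (Fmod fin : model xb0)).
  by apply: (gr_coef_inj fh gh fK fi gi) => t; rewrite GE g0K.
pose H y := sval (cid (Gsurj y)).
have HK : cancel H G by move=> y; exact: svalP (cid (Gsurj y)).
have GK : cancel G H by move=> u; apply: Ginj; rewrite HK.
exists H; last by exists G.
split=> [c y z|y z|y z]; apply: Ginj.
- by rewrite Gl !HK.
- by case: Gh => _ -> _; rewrite !HK.
- by case: Gh => _ _ ->; rewrite !HK.
Qed.
End PBW.

Theorem corollary3 (k : fieldType) :
  (forall (A : assocType k) (X : choiceType) (le : rel X) (x : X -> A),
     well_order le -> lin_basis x ->
     forall (U : preAsType k) (iota : A -> U), universal_envelope iota ->
       lin_basis (fun w : normal_form X => nf_val (fun i => iota (x i)) w))
  /\ (forall (A : assocType k)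
        (U : preAsType k) (iota : A -> U)
        (U0 : preAsType k) (iota0 : zero_alg A -> U0),
      universal_envelope iota -> universal_envelope iota0 ->
      pre_iso (gr (natural_filtration iota)) U0).
Proof.
split=> [A X le x _ xb U iota Uu|A U iota U0 iota0 Uu U0u].
  exact: nf_basis xb Uu.
exact: gr_envelope_iso Uu U0u.
Qed.
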